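(* Let $n\ge1$ and let $Q\in\mathcal{Q}_n$ have parameters $r_1, r_2, s_1$ and $s_2$. Then $Q$ is mutation equivalent to a non-oriented cycle of length $n+1$ with parameters $r=r_1+2r_2$ and $s=s_1+2s_2$, i.e. a non-oriented cycle with $r$ arrows oriented in the anti-clockwise direction and $s$ arrows oriented in the clockwise direction.
   Context: Quivers and mutation. A quiver is a finite directed graph. Let $Q$ be a quiver without loops and oriented $2$-cycles. The mutation of $Q$ at a vertex $k$ is the quiver $Q^*$ obtained as follows: add a new vertex $k^*$; if there are $r>0$ arrows $i\to k$, $s>0$ arrows $k\to j$ and $t\in\mathbb{Z}$ arrows $j\to i$ in $Q$, then there are $t-rs$ arrows $j\to i$ in $Q^*$ (a negative number of arrows means arrows in the opposite direction); for any vertex $i$ replace all arrows $i\to k$ by arrows $k^*\to i$ and all arrows $k\to i$ by arrows $i\to k^*$; remove $k$. Two quivers are mutation equivalent if one can be obtained (up to isomorphism) from the other by a finite sequence of mutations. A non-oriented cycle of length $m\ge 2$ is a quiver whose underlying graph is a cycle with $m$ vertices and $m$ edges (for $m=2$, a double arrow) and which is not an oriented cycle. Quivers of type $A_k$. Below, a quiver of type $A_k$ means a quiver mutation equivalent to an orientation of the Dynkin diagram $A_k$; equivalently (Buan-Vatne), a connected quiver with $k$ vertices such that all non-trivial cycles in the underlying graph (not passing through the same edge twice) are oriented and of length $3$; each vertex has at most four incident arrows; if a vertex has four incident arrows, two of them belong to one oriented $3$-cycle and the other two to another oriented $3$-cycle; if a vertex has three incident arrows, two of them belong to an oriented $3$-cycle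 and the third does not belong to any oriented $3$-cycle. The class $\mathcal{Q}_n$. It is the class of connected quivers $Q$ with $n+1$ vertices such that: (i) there is precisely one full subquiver which is a non-oriented cycle of length $\ge 2$ (if the length is two, it is a double arrow); (ii) for each arrow $\alpha: x\to y$ of this non-oriented cycle there may (or may not) be a vertex $z_\alpha$ not on the non-oriented cycle such that there is an oriented $3$-cycle $x\xrightarrow{\alpha} y\to z_\alpha\to x$, and apart from the arrows of these oriented $3$-cycles there are no other arrows incident to vertices on the non-oriented cycle; (iii) if all vertices of the non-oriented cycle and their incident arrows are removed, the result is a disjoint union of quivers $Q_\alpha$, one for each $z_\alpha$ (with $z_\alpha$ a vertex of $Q_\alpha$), each $Q_\alpha$ is a quiver of type $A_{k_\alpha}$ for some $k_\alpha\ge1$, the vertex $z_\alpha$ has at most two incident arrows in $Q_\alpha$, and if it has two, then $z_\alpha$ is a vertex of an oriented $3$-cycle in $Q_\alpha$. Convention: if the non-oriented cycle is a double arrow, only one of the two arrows is chosen to be part of the oriented $3$-cycle through a given vertex $z_\alpha$ (different vertices $z$ being attached to different arrows). Parameters. For $Q\in\mathcal{Q}_n$ fix a drawing of $Q$ in the plane without arrow-crossing, so that each arrow of the non-oriented cycle is clockwise or anti-clockwise oriented; this is unique up to reflection of the non-oriented cycle, i.e. up to changing the roles of clockwise and anti-clockwise. Then $r_1$ is the number of arrows that are not part of any oriented $3$-cycle and that either lie on the non-oriented cycle and are oriented anti-clockwise, or lie in some $Q_\alpha$ with $\alpha$ an anti-clockwise arrow of the non-oriented cycle. And $r_2$ is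 the number of oriented $3$-cycles that either share an arrow $\alpha$ with the non-oriented cycle where $\alpha$ is oriented anti-clockwise, or lie in some $Q_\alpha$ with $\alpha$ an anti-clockwise arrow of the non-oriented cycle. The parameters $s_1,s_2$ are defined in the same way with ''clockwise'' instead of ''anti-clockwise''. *)

(* Defs.v *)
From mathcomp Require Import all_boot all_order all_algebra.

Set Implicit Arguments.
Unset Strict Implicit.
Unset Printing Implicit Defensive.

(* Finite directed multigraphs; absence of loops and oriented 2-cycles is the
   separate predicate [loop2_free]. *)
Record quiver := Quiver {
  vertex : finType;
  arrow : finType;
  src : arrow -> vertex;
  tgt : arrow -> vertex
}.

Section Quivers.
Variable Q : quiver.

Definition loop2_free : Prop :=
  (forall a : arrow Q, src a <> tgt a) /\
  (forall a b : arrow Q, ~ (src a = tgt b /\ tgt a = src b)).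

Definition arrows (i j : vertex Q) : {set arrow Q} :=
  [set a | (src a == i) && (tgt a == j)].

Definition arrows_in (S : {set vertex Q}) : {set arrow Q} :=
  [set a | (src a \in S) && (tgt a \in S)].

Definition incident (a : arrow Q) (x : vertex Q) : bool :=
  (src a == x) || (tgt a == x).

Definition connected : Prop :=
  forall x y : vertex Q,
    connect (fun u v => (arrows u v != set0) || (arrows v u != set0)) x y.

Section FullSubquiver.
Variable S : {set vertex Q}.

Fact full_src_subproof (a : {a | a \in arrows_in S}) : src (val a) \in S.
Proof. by case: a => a /=; rewrite inE => /andP[]. Qed.

Fact full_tgt_subproof (a : {a | a \in arrows_in S}) : tgt (val a) \in S.
Proof. by case: a => a /=; rewrite inE => /andP[]. Qed.

Definition full_subquiver : quiver :=
  @Quiver {x : vertex Q | x \in S} {a : arrow Q | a \in arrows_in S}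
    (fun a => exist _ (src (val a)) (full_src_subproof a))
    (fun a => exist _ (tgt (val a)) (full_tgt_subproof a)).
End FullSubquiver.

Definition oriented_3cycle (a b c : arrow Q) : bool :=
  [&& uniq [:: src a; src b; src c],
      tgt a == src b, tgt b == src c & tgt c == src a].

(* An oriented 3-cycle is identified with its set of three arrows. *)
Definition triangles : {set {set arrow Q}} :=
  [set T | [exists a, exists b, exists c,
             oriented_3cycle a b c && (T == [set a; b; c])]].

(* The number of arrows i -> j as an integer, arrows j -> i being counted
   negatively. *)
Definition net (i j : vertex Q) : int :=
  ((#|arrows i j|)%:Z - (#|arrows j i|)%:Z)%R.

(* The new vertex k^* is named k again.  Without 2-cycles at k, at most one of
   the two products below is nonzero. *)
Definition mutation_net (k j i : vertex Q) : int :=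
  (if (j == k) || (i == k) then net i j
   else net j i - (#|arrows i k| * #|arrows k j|)%N%:Z
                + (#|arrows j k| * #|arrows k i|)%N%:Z)%R.

Definition mutation (k : vertex Q) : quiver :=
  @Quiver (vertex Q)
    {p : vertex Q * vertex Q & 'I_(absz (Num.max 0%R (mutation_net k p.1 p.2)))}
    (fun a => (tag a).1) (fun a => (tag a).2).

End Quivers.

Definition isomorphic (Q Q' : quiver) : Prop :=
  exists (fv : vertex Q -> vertex Q') (fa : arrow Q -> arrow Q'),
    [/\ bijective fv, bijective fa,
        forall a, src (fa a) = fv (src a) &
        forall a, tgt (fa a) = fv (tgt a)].

Inductive mutation_reachable : quiver -> quiver -> Prop :=
| reach_iso (Q Q' : quiver) : isomorphic Q Q' -> mutation_reachable Q Q'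
| reach_step (Q Q' : quiver) (k : vertex Q) :
    loop2_free Q -> mutation_reachable (mutation k) Q' ->
    mutation_reachable Q Q'.

Definition mutation_equivalent (Q Q' : quiver) : Prop :=
  mutation_reachable Q Q' \/ mutation_reachable Q' Q.

(* The orientation o of the Dynkin diagram A_(k+1): arrow a joins the vertices
   a and a+1, and starts at a when o a holds. *)
Definition dynkin_A (k : nat) (o : 'I_k -> bool) : quiver :=
  let lo (a : 'I_k) : 'I_k.+1 := widen_ord (leqnSn k) a in
  let hi (a : 'I_k) : 'I_k.+1 := lift ord0 a in
  @Quiver 'I_k.+1 'I_k
    (fun a => if o a then lo a else hi a)
    (fun a => if o a then hi a else lo a).

Definition type_A (Q : quiver) : Prop :=
  exists (k : nat) (o : 'I_k -> bool), mutation_equivalent Q (dynkin_A o).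

(* The vertices 0, ..., m-1 are placed clockwise on a circle; arrow i joins the
   vertices i and i+1 mod m, and is clockwise (i -> i+1) when cw i holds,
   anti-clockwise (i+1 -> i) otherwise. *)
Definition cycle_quiver (m : nat) (cw : 'I_m -> bool) : quiver :=
  @Quiver 'I_m 'I_m
    (fun i => if cw i then i else ordS i)
    (fun i => if cw i then ordS i else i).

Definition nonoriented (m : nat) (cw : 'I_m -> bool) : bool :=
  [&& 1 < m, [exists i, cw i] & [exists i, ~~ cw i]].

Definition is_nonoriented_cycle (Q : quiver) : Prop :=
  exists (m : nat) (cw : 'I_m -> bool),
    nonoriented cw /\ isomorphic Q (cycle_quiver cw).

(* What a plane drawing of a quiver of the class Q_n contributes is a direction
   of traversal of its non-oriented cycle.  [drawing] records the non-oriented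
   cycle traversed clockwise, the arrows y -> z and z -> x completing
   the i-th arrow x -> y of the cycle to its chosen oriented 3-cycle (if any),
   and the vertices of the quiver attached at z. *)
Record drawing (Q : quiver) := Drawing {
  len : nat;
  cw : 'I_len -> bool;
  cv : 'I_len -> vertex Q;
  ca : 'I_len -> arrow Q;
  side : 'I_len -> option (arrow Q * arrow Q);
  branch : 'I_len -> {set vertex Q}
}.

Arguments cw {Q} d i.
Arguments cv {Q} d i.
Arguments ca {Q} d i.
Arguments side {Q} d i.
Arguments branch {Q} d i.

Section Drawings.
Variables (Q : quiver) (D : drawing Q).

Definition cycle_vertices : {set vertex Q} := [set cv D i | i in 'I_(len D)].

Record draws_cycle : Prop := DrawsCycle {
  dc_nonoriented : nonoriented (cw D);
  dc_cv_inj : injective (cv D);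
  dc_ca_inj : injective (ca D);
  dc_src : forall i, src (ca D i) = cv D (@src (cycle_quiver (cw D)) i);
  dc_tgt : forall i, tgt (ca D i) = cv D (@tgt (cycle_quiver (cw D)) i);
  dc_full : forall a, a \in arrows_in cycle_vertices -> exists i, a = ca D i
}.

Definition good_branch (i : 'I_(len D)) : Prop :=
  if side D i is Some (b, c) then
    let z := tgt b in
    let inc := [set a in arrows_in (branch D i) | incident a z] in
    [/\ oriented_3cycle (ca D i) b c,
        z \in branch D i,
        type_A (full_subquiver (branch D i)),
        #|inc| <= 2 &
        #|inc| = 2 ->
          exists2 T, T \in triangles Q &
            T \subset arrows_in (branch D i) /\ exists2 a, a \in T & src a = z]
  else branch D i = set0.

Definition on_side (a : arrow Q) (i : 'I_(len D)) : bool :=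
  if side D i is Some (b, c) then (a == b) || (a == c) else false.

(* The quiver belongs to the class Q_n, as witnessed by the drawing. *)
Record in_Qn (n : nat) : Prop := InQn {
  Qn_card : #|vertex Q| = n.+1;
  Qn_connected : connected Q;
  Qn_unique : exists! S : {set vertex Q},
    is_nonoriented_cycle (full_subquiver S);
  Qn_cycle : draws_cycle;
  Qn_branch : forall i, good_branch i;
  Qn_no_other_arrow : forall a x, x \in cycle_vertices -> incident a x ->
    (exists i, a = ca D i) \/ (exists i, on_side a i);
  Qn_disjoint : forall i j, i != j -> [disjoint branch D i & branch D j];
  Qn_cover : \bigcup_i branch D i = ~: cycle_vertices;
  Qn_union : forall a, a \in arrows_in (~: cycle_vertices) ->
    exists i, a \in arrows_in (branch D i)
}.

(* If the non-oriented cycle is a double arrow, each of its arrows forms an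
   oriented 3-cycle with every z; only the chosen 3-cycles are retained.  When
   the cycle is longer the extra condition is automatic. *)
Definition chosen_triangles : {set {set arrow Q}} :=
  [set T in triangles Q | [forall i, (ca D i \in T) ==>
     (if side D i is Some (b, c) then T == [set ca D i; b; c] else false)]].

Definition param1 (clockwise : bool) : nat :=
  #|[set a | (a \notin cover chosen_triangles) &&
     [exists i, (cw D i == clockwise) &&
                ((a == ca D i) || (a \in arrows_in (branch D i)))]]|.

Definition param2 (clockwise : bool) : nat :=
  #|[set T in chosen_triangles |
     [exists i, (cw D i == clockwise) &&
                ((ca D i \in T) || (T \subset arrows_in (branch D i)))]]|.

Definition r1 := param1 false.
Definition r2 := param2 false.
Definition s1 := param1 true.
Definition s2 := param2 true.

End Drawings.

(* Main.v *)
Require Import Defs.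
From mathcomp Require Import all_boot all_order all_algebra.
From mathcomp Require Import zify ring.

(* Quivers of type A come from triangulations of a polygon, hence from binary
   trees: rooted at a vertex [z], such a quiver consists of two binary trees
   sharing the root [z].  Orientations of A_k have this shape, any vertex may
   serve as the root, and mutation at the root merely permutes the four
   subtrees.  The conditions on z_alpha say that one of the two trees at z_alpha
   is trivial, so that Q is a non-oriented cycle with a binary tree t_i (possibly
   empty) hanging from its i-th arrow.

   If the tree hanging from x -> y has root z and subtrees L and R, mutation
   at z replaces the arrow x -> y by x -> z -> y, with R hanging from x -> z and
   L from z -> y.  Repeating this exhausts the trees and keeps, in each
   direction of the cycle, the sum of the numbers 1 + #t_i.  A binary tree with k
   nodes, u arrows outside the 3-cycles and t of them satisfies k = 1 + u + 2t,
   so these sums are r1 + 2 r2 and s1 + 2 s2. *)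

Set Implicit Arguments.
Unset Strict Implicit.
Unset Printing Implicit Defensive.

(** * Mutation in terms of arrow counts *)

(** The arrows of [mutation k] form a new type, so no arrow of [Q] can be followed through a
    mutation. Everything is therefore phrased with the counts [adj], which determine a quiver up to
    isomorphism, and a quiver is described by a list of vertex pairs up to permutation; lists rather
    than sets, since the non-oriented cycle may be a double arrow. Both kinds of mutation needed are
    instances of [flip_represents]: at the root of a type A quiver both triangles belong to the
    trees, at the root of a hanging tree one of them contains the cycle arrow. The point to check
    each time is that no surviving arrow is opposite to a new one. As [mutation_equivalent] allows
    sequences in either direction, the tree shape has to be an invariant, not merely preserved
    forwards; this is why mutation must be shown to be an involution. *)

Definition adj (Q : quiver) (p q : vertex Q) : nat := #|arrows p q|.

Lemma adj_mutation (Q : quiver) (k p q : vertex Q) :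
  @adj (mutation k) p q = absz (Num.max 0%R (mutation_net k p q)).
Proof.
pose T (r : vertex Q * vertex Q) := 'I_(absz (Num.max 0%R (mutation_net k r.1 r.2))).
have -> : @adj (mutation k) p q = #|[set Tagged T x | x : T (p, q)]|.
  rewrite /adj; apply: eq_card => a; rewrite !inE; apply/andP/imsetP => /=.
    case: a => [[p' q'] x] /= [/eqP ep /eqP eq]; subst p' q'.
    by exists x.
  by case=> x _ ->.
rewrite card_imset ?card_ord // => x y /eqP.
by rewrite eq_Tagged /= => /eqP.
Qed.

(** Arrows with the same ends are interchangeable, so equal counts suffice to choose a bijection of
    arrows over a given bijection of vertices. *)
Lemma isomorphicP (Q Q' : quiver) : isomorphic Q Q' <->
  exists2 f : vertex Q -> vertex Q', bijective f &
    forall p q, adj (f p) (f q) = adj p q.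
Proof.
split=> [[f [g [bf bg es et]]]|[f bf eadj]].
  exists f => // p q; rewrite -[RHS](card_imset _ (bij_inj bg)).
  apply: eq_card => a; apply/idP/imsetP.
    case: bg => h hK gK; rewrite inE -(gK a) es et !(inj_eq (bij_inj bf)).
    by move=> pq; exists (h a); rewrite ?inE.
  by case=> b; rewrite inE => /andP[/eqP <- /eqP <-] ->; rewrite inE es et !eqxx.
(* [g a] is the arrow of the same rank in the enumeration of the arrows between the image vertices;
   equal counts keep the rank in range. *)
have /fin_all_exists[g gP] (a : arrow Q) : exists b : arrow Q',
    exists2 i, index a (enum (arrows (src a) (tgt a))) = i &
    b = nth b (enum (arrows (f (src a)) (f (tgt a)))) i /\
    i < size (enum (arrows (f (src a)) (f (tgt a)))).
  set i := index _ _.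
  have lti: i < size (enum (arrows (f (src a)) (f (tgt a)))).
    rewrite -cardE -/(adj _ _) eadj /adj cardE index_mem mem_enum inE.
    by rewrite !eqxx.
  case E: (enum _) lti => [//|b0 s] lti.
  exists (nth b0 (b0 :: s) i); exists i => //.
  by split; rewrite // (set_nth_default b0).
have gst a : g a \in enum (arrows (f (src a)) (f (tgt a))).
  by have [i _ [-> lti]] := gP a; apply: mem_nth.
have gs a : src (g a) = f (src a) /\ tgt (g a) = f (tgt a).
  by have := gst a; rewrite mem_enum inE => /andP[/eqP ? /eqP].
have ginj : injective g.
  move=> a b eab; have [sa ta] := gs a; have [sb tb] := gs b.
  have es : src a = src b by apply: (bij_inj bf); rewrite -sa -sb eab.
  have et : tgt a = tgt b by apply: (bij_inj bf); rewrite -ta -tb eab.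
  have [i ia [gia lti]] := gP a; have [j jb [gjb ltj]] := gP b.
  have eij : i = j.
    rewrite -es -et in gjb ltj; apply/eqP.
    rewrite -(nth_uniq (g a) lti ltj (enum_uniq _)) -gia eab {1}gjb.
    by apply/eqP/set_nth_default.
  have ain : a \in enum (arrows (src a) (tgt a)) by rewrite mem_enum inE !eqxx.
  have bin : b \in enum (arrows (src a) (tgt a)).
    by rewrite mem_enum inE es et !eqxx.
  rewrite -(nth_index a ain) ia eij -jb -es -et nth_index //.
have gsurj (b : arrow Q') : exists a, g a = b.
  case: (bf) => h fK hK.
  pose p := h (src b); pose q := h (tgt b).
  have sub : [set g a | a in arrows p q] \subset arrows (src b) (tgt b).
    apply/subsetP => _ /imsetP[a + ->]; rewrite !inE => /andP[/eqP ap /eqP aq].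
    by have [-> ->] := gs a; rewrite ap aq !hK !eqxx.
  have /subset_leqif_cards/leqifP := sub.
  have -> : #|[set g a | a in arrows p q]| = #|arrows (src b) (tgt b)|.
    by rewrite card_imset // -/(adj _ _) -eadj /adj !hK.
  rewrite ltnn; case: eqP => // e _.
  have : b \in arrows (src b) (tgt b) by rewrite inE !eqxx.
  by rewrite -e => /imsetP[a _ ->]; exists a.
exists f, g; split=> // [|a|a]; try by case: (gs a).
have [h hP] := fin_all_exists gsurj.
by exists h => // a; apply: ginj; rewrite hP.
Qed.

(** The case [p = q] is what excludes loops. *)
Lemma loop2_freeP (Q : quiver) : loop2_free Q <->
  forall p q : vertex Q, adj p q = 0 \/ adj q p = 0.
Proof.
split=> [[_ l2] p q|l2].
  case: (set_0Vmem (arrows p q)) => [e|[a]]; first by left; rewrite /adj e cards0.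
  case: (set_0Vmem (arrows q p)) => [e|[b]]; first by right; rewrite /adj e cards0.
  rewrite !inE => /andP[/eqP sb /eqP tb] /andP[/eqP sa /eqP ta].
  by case: (l2 a b); rewrite sa ta sb tb.
have np (a : arrow Q) : adj (src a) (tgt a) != 0.
  by rewrite cards_eq0; apply/set0Pn; exists a; rewrite inE !eqxx.
split=> [a sa|a b [sa ta]].
  by have := np a; rewrite sa; case: (l2 (tgt a) (tgt a)) => ->.
have := np a; have := np b; rewrite sa ta.
by case: (l2 (src b) (tgt b)) => ->.
Qed.

Lemma mutation_netN (Q : quiver) (k p q : vertex Q) :
  mutation_net k q p = (- mutation_net k p q)%R.
Proof. rewrite /mutation_net orbC /net; case: ifP => _; ring. Qed.

(** Because [mutation_net] is antisymmetric, truncating it at 0 loses nothing: the net counts of the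
    mutation are exactly [mutation_net]. All arrows at [k] are reversed, so the second mutation adds
    the product terms with the opposite sign and they cancel. *)
Lemma adj_mutationK (Q : quiver) (k : vertex Q) : loop2_free Q ->
  forall p q : vertex Q, @adj (@mutation (mutation k) k) p q = adj p q.
Proof.
move=> /loop2_freeP l2 p q; rewrite adj_mutation.
have b' (x y : vertex Q) : @net (mutation k) x y = mutation_net k x y.
  rewrite /net -!/(@adj (mutation k) _ _) !adj_mutation (mutation_netN k x y); lia.
have ek (x : vertex Q) : @adj (mutation k) x k = @adj Q k x.
  rewrite adj_mutation /mutation_net eqxx orbT /net -!/(@adj Q _ _).
  by case: (l2 x k) => ->; lia.
have ke (x : vertex Q) : @adj (mutation k) k x = @adj Q x k.
  rewrite adj_mutation /mutation_net eqxx /= /net -!/(@adj Q _ _).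
  by case: (l2 x k) => ->; lia.
rewrite {1}/mutation_net !b' -!/(@adj (mutation k) _ _) !ek !ke.
rewrite /mutation_net [(q == k) || _]orbC /net -!/(@adj Q _ _).
by case: ((p == k) || (q == k)); case: (l2 p q) => ->; lia.
Qed.

Lemma loop2_free_mutation (Q : quiver) (k : vertex Q) : loop2_free (mutation k).
Proof. by apply/loop2_freeP => p q; rewrite !adj_mutation mutation_netN; lia. Qed.

(** * Binary trees and flips *)

Inductive tree (V : Type) := Leaf | Node of V & tree V & tree V.
Arguments Leaf {V}.

Section Trees.
Variable V : eqType.
Implicit Types (t l r : tree V) (a b : option V).

Definition troot t : option V := if t is Node x _ _ then Some x else None.

Fixpoint labels t : seq V :=
  if t is Node x l r then x :: labels l ++ labels r else [::].

Definition arr a b : seq (V * V) :=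
  if (a, b) is (Some x, Some y) then [:: (x, y)] else [::].

Definition tri a b c : seq (V * V) := arr a b ++ arr b c ++ arr c a.

(* Each node is joined to its children by arrows [x -> left child] and
   [right child -> x]; two siblings are joined by [left -> right]. *)
Fixpoint tarr t : seq (V * V) :=
  if t is Node x l r
  then tri (Some x) (troot l) (troot r) ++ tarr l ++ tarr r else [::].

Lemma count_arr a b p q :
  count_mem (p, q) (arr a b) = (a == Some p) && (b == Some q) :> nat.
Proof.
case: a b => [x|] [y|] //=; last by rewrite andbF.
by rewrite addn0 xpair_eqE.
Qed.

Lemma mem_arr a b p q :
  ((p, q) \in arr a b) = (a == Some p) && (b == Some q).
Proof. by rewrite -has_pred1 has_count count_arr; case: (_ && _). Qed.

Lemma mem_tri a b c p q :
  ((p, q) \in tri a b c) = [|| (a == Some p) && (b == Some q),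
    (b == Some p) && (c == Some q) | (c == Some p) && (a == Some q)].
Proof. by rewrite !mem_cat !mem_arr. Qed.

Lemma mem_troot t x : troot t = Some x -> x \in labels t.
Proof. by case: t => //= y l r [->]; rewrite mem_head. Qed.

Lemma tarr_labels t p q :
  (p, q) \in tarr t -> (p \in labels t) && (q \in labels t).
Proof.
elim: t => //= x l IHl r IHr; rewrite !(mem_cat, inE) !mem_arr -!orbA.
case/or4P=> [/andP[/eqP[->] /eqP/mem_troot ->]|/andP[/eqP/mem_troot -> /eqP/mem_troot ->]
  |/andP[/eqP/mem_troot -> /eqP[->]]|/orP[/IHl/andP[-> ->]|/IHr/andP[-> ->]]];
  by rewrite ?eqxx ?orbT.
Qed.

End Trees.

Definition represents (Q : quiver) (E : seq (vertex Q * vertex Q)) : Prop :=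
  forall p q, adj p q = count_mem (p, q) E.

Lemma absz_max_subz (m n : nat) :
  m = 0 \/ n = 0 -> absz (Num.max 0%R (m%:Z - n%:Z)%R) = m.
Proof. by case=> ->; lia. Qed.

(* The flip of the diagonal [z] in a triangulated surface: before it, the two
   triangles at [z] have sides [a, b] and [a', b'], after it [b, a'] and
   [b', a]. *)
Lemma flip_represents (Q : quiver) (z : vertex Q) (a b a' b' : option (vertex Q))
    (C : seq (vertex Q * vertex Q)) :
  loop2_free Q ->
  represents (tri (Some z) a b ++ tri (Some z) a' b' ++ C) ->
  uniq (z :: pmap id [:: a; b; a'; b']) ->
  (forall p q, (p, q) \in C -> (p != z) && (q != z)) ->
  (forall x y, a = Some x -> b' = Some y -> (x, y) \notin C) ->
  (forall x y, a' = Some x -> b = Some y -> (x, y) \notin C) ->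
  @represents (mutation z) (tri (Some z) b a' ++ tri (Some z) b' a ++ C).
Proof.
move=> /loop2_freeP l2 rQ u Cz Cab Cba.
suff main (p q : vertex Q) : absz (Num.max 0%R (mutation_net z p q)) =
    count_mem (p, q) (tri (Some z) b a' ++ tri (Some z) b' a ++ C).
  by move=> p q; rewrite adj_mutation main.
have nz : [/\ a <> Some z, b <> Some z, a' <> Some z & b' <> Some z].
  split=> e; move: u; rewrite e; case: (a) (b) (a') (b') => [?|] [?|] [?|] [?|];
  by rewrite /= !inE eqxx ?orbT.
have dab x : ~~ ((a == Some x) && (b == Some x)).
  apply/negP => /andP[/eqP ea /eqP eb]; move: u; rewrite ea eb.
  by case: (a') (b') => [?|] [?|]; rewrite /= !inE eqxx ?orbT ?andbF.
have daa x : ~~ ((a == Some x) && (a' == Some x)).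
  apply/negP => /andP[/eqP ea /eqP eb]; move: u; rewrite ea eb.
  by case: (b) (b') => [?|] [?|]; rewrite /= !inE eqxx ?orbT ?andbF.
have dab' x : ~~ ((a == Some x) && (b' == Some x)).
  apply/negP => /andP[/eqP ea /eqP eb]; move: u; rewrite ea eb.
  by case: (b) (a') => [?|] [?|]; rewrite /= !inE eqxx ?orbT ?andbF.
have dba x : ~~ ((b == Some x) && (a' == Some x)).
  apply/negP => /andP[/eqP ea /eqP eb]; move: u; rewrite ea eb.
  by case: (a) (b') => [?|] [?|]; rewrite /= !inE eqxx ?orbT ?andbF.
have dbb x : ~~ ((b == Some x) && (b' == Some x)).
  apply/negP => /andP[/eqP ea /eqP eb]; move: u; rewrite ea eb.
  by case: (a) (a') => [?|] [?|]; rewrite /= !inE eqxx ?orbT ?andbF.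
have da'b' x : ~~ ((a' == Some x) && (b' == Some x)).
  apply/negP => /andP[/eqP ea /eqP eb]; move: u; rewrite ea eb.
  by case: (a) (b) => [?|] [?|]; rewrite /= !inE eqxx ?orbT ?andbF.
have C0 x y : (x == z) || (y == z) -> count_mem (x, y) C = 0.
  move=> xyz; apply/count_memPn/negP => /Cz; apply/negP.
  by rewrite negb_and !negbK.
have Cab0 x y : (a == Some x) && (b' == Some y) -> count_mem (x, y) C = 0.
  by move=> /andP[/eqP ea /eqP eb]; apply/count_memPn/Cab.
have Cba0 x y : (a' == Some x) && (b == Some y) -> count_mem (x, y) C = 0.
  by move=> /andP[/eqP ea /eqP eb]; apply/count_memPn/Cba.
case: nz => /eqP/negPf az /eqP/negPf bz /eqP/negPf a'z /eqP/negPf b'z.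
have eqS (x y : vertex Q) : (Some x == Some y :> option (vertex Q)) = (y == x).
  by rewrite eq_sym.
have cQ x y : adj x y =
  (x == z) * ((a == Some y) + (a' == Some y)) +
  (y == z) * ((b == Some x) + (b' == Some x)) +
  ((a == Some x) * (b == Some y) + (a' == Some x) * (b' == Some y))
   + count_mem (x, y) C.
  rewrite rQ !count_cat !count_arr. rewrite !eqS. rewrite -!mulnb. ring.
pose c x y : nat :=
  (x == z) * ((b == Some y) + (b' == Some y)) +
  (y == z) * ((a == Some x) + (a' == Some x)) +
  ((b == Some x) * (a' == Some y) + (b' == Some x) * (a == Some y))
   + count_mem (x, y) C.
have cE x y : count_mem (x, y) (tri (Some z) b a' ++ tri (Some z) b' a ++ C) = c x y.
  rewrite /c !count_cat !count_arr !eqS -!mulnb; ring.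
have cz x : c z x = (b == Some x) + (b' == Some x).
  rewrite /c C0 ?eqxx // az bz a'z b'z /=; ring.
have czr x : c x z = (a == Some x) + (a' == Some x).
  rewrite /c C0 ?eqxx ?orbT // az bz a'z b'z /=; ring.
have adjz x : adj z x = (a == Some x) + (a' == Some x).
  rewrite cQ C0 ?eqxx // az bz a'z b'z /=; ring.
have adjzr x : adj x z = (b == Some x) + (b' == Some x).
  rewrite cQ C0 ?eqxx ?orbT // az bz a'z b'z /=; ring.
have -> : mutation_net z p q = ((c p q)%:Z - (c q p)%:Z)%R.
  rewrite /mutation_net /net -!/(@adj Q _ _) !adjz !adjzr.
  case: eqVneq => [->|np] /=; first by rewrite adjz adjzr cz czr.
  case: eqVneq => [->|nq] /=; first by rewrite adjz adjzr cz czr.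
  rewrite !cQ /c (negPf np) (negPf nq) /=.
  move: (count _ C) (count _ C) => u1 u2.
  rewrite !(PoszD, PoszM); ring.
(* The net counts agree; the counts themselves agree once the claimed list has no pair of opposite
   arrows. *)
rewrite cE; apply: absz_max_subz.
case: (eqVneq p z) => [->|np].
  rewrite cz czr; move: (dab q) (dab' q) (daa q) (dbb q) (dba q) (da'b' q); clear.
  by case: (a == Some q); case: (b == Some q); case: (a' == Some q);
    case: (b' == Some q) => //= *; auto.
case: (eqVneq q z) => [->|nq].
  rewrite cz czr; move: (dab p) (dab' p) (daa p) (dbb p) (dba p) (da'b' p); clear.
  by case: (a == Some p); case: (b == Some p); case: (a' == Some p);
    case: (b' == Some p) => //= *; auto.
(* Away from [z], two opposite arrows of [C] would already be a 2-cycle of [Q]. The new arrows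
   [b -> a'] and [b' -> a] have no opposite in [C] by the last two hypotheses on [C]. *)
have := l2 p q; rewrite !cQ /c (negPf np) (negPf nq) /= !mul0n !add0n.
move: (Cab0 p q) (Cab0 q p) (Cba0 p q) (Cba0 q p).
move: (count _ C) (count _ C) => u1 u2.
move: (dab p) (dab' p) (daa p) (dbb p) (dba p) (da'b' p).
move: (dab q) (dab' q) (daa q) (dbb q) (dba q) (da'b' q); clear.
case: (a == Some p); case: (b == Some p); case: (a' == Some p);
  case: (b' == Some p) => //=;
case: (a == Some q); case: (b == Some q); case: (a' == Some q);
  case: (b' == Some q) => //= _ _ _ _ _ _ _ _ _ _ _ _ h1 h2 h3 h4;
  rewrite ?(h1 isT) ?(h2 isT) ?(h3 isT) ?(h4 isT); lia.
Qed.

(** * Quivers of type A *)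

Lemma uniq_countP (T : eqType) (s : seq T) :
  reflect (forall x, count_mem x s <= 1) (uniq s).
Proof.
apply: (iffP idP) => [u x|le1]; first by rewrite count_uniq_mem ?leq_b1.
apply: count_mem_uniq => x; have := le1 x.
rewrite -has_pred1 has_count; lia.
Qed.

Lemma mem_count (T : eqType) (s : seq T) x : (x \in s) = (0 < count_mem x s).
Proof. by rewrite -has_pred1 has_count. Qed.

Section Reroot.
Variable V : eqType.
Implicit Types (t l r : tree V).

(** The root moves one tree edge at a time by reading a 3-cycle from another corner, which only
    rotates [tri]. For the left child y of [x], the sibling becomes the left child on the second
    side of y and [x] the right one; [x] keeps its own second side as its subtrees. The right child
    is symmetric. *)
Lemma reroot t l2 r2 x l r k : t = Node x l r -> k \in labels t ->
  exists l1' r1' l2' r2',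
    perm_eq (tarr (Node k l1' r1') ++ tarr (Node k l2' r2'))
            (tarr t ++ tarr (Node x l2 r2)) /\
    perm_eq (labels (Node k l1' r1') ++ labels l2' ++ labels r2')
            (labels t ++ labels l2 ++ labels r2).
Proof.
elim: t l2 r2 x l r => [|x l IHl r IHr] l2 r2 x0 l0 r0 //= [<- _ _].
rewrite inE; have [-> _|_ /=] := eqVneq k x; first by exists l, r, l2, r2.
rewrite mem_cat; case/orP.
  case: l IHl => // y L R IHl kl.
  have [l1' [r1' [l2' [r2' [pa pl]]]]] := IHl r (Node x l2 r2) _ _ _ erefl kl.
  exists l1', r1', l2', r2'; split; [apply: (perm_trans pa)|apply: (perm_trans pl)];
    apply/permP => P; rewrite /= ?count_cat /= ?count_cat /=; lia.
case: r IHr => // y L R IHr kr.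
have [l1' [r1' [l2' [r2' [pa pl]]]]] := IHr (Node x l2 r2) l _ _ _ erefl kr.
exists l1', r1', l2', r2'; split; [apply: (perm_trans pa)|apply: (perm_trans pl)];
  apply/permP => P; rewrite /= ?count_cat /= ?count_cat /=; lia.
Qed.

Lemma subseq_troot t (o : seq (option V)) s :
  subseq (pmap id o) s -> subseq (pmap id (troot t :: o)) (labels t ++ s).
Proof.
case: t => [|x l r] //= os; rewrite eqxx.
exact: subseq_trans os (suffix_subseq _ _).
Qed.
End Reroot.

Lemma represents_perm (Q : quiver) (E E' : seq (vertex Q * vertex Q)) :
  perm_eq E E' -> represents E -> represents E'.
Proof. by move=> /permP pE rE p q; rewrite rE pE. Qed.

(* The triangulation read from the diagonal [z], with one binary tree on each
   side; the two trees share the root [z]. *)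
Definition two_sided (Q : quiver) (z : vertex Q) (l1 r1 l2 r2 : tree (vertex Q)) :=
  [/\ uniq (labels (Node z l1 r1) ++ labels l2 ++ labels r2),
      forall x, x \in labels (Node z l1 r1) ++ labels l2 ++ labels r2 &
      represents (tarr (Node z l1 r1) ++ tarr (Node z l2 r2))].

Definition tree_like (Q : quiver) :=
  exists (z : vertex Q) (l1 r1 l2 r2 : tree (vertex Q)), two_sided z l1 r1 l2 r2.

Lemma two_sided_reroot (Q : quiver) (k : vertex Q) : tree_like Q ->
  exists l1 r1 l2 r2 : tree (vertex Q), two_sided k l1 r1 l2 r2.
Proof.
case=> z [l1 [r1 [l2 [r2 [u cov rep]]]]].
wlog kl : l1 r1 l2 r2 u cov rep / k \in labels (Node z l1 r1).
  move=> wl; have := cov k; rewrite mem_cat; case/orP; first exact: (wl l1 r1 l2 r2).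
  move=> kl; have [||||l [r [l' [r' tw]]]] := wl l2 r2 l1 r1.
  - rewrite -(perm_uniq (s1 := labels (Node z l1 r1) ++ labels l2 ++ labels r2)) //.
    by apply/permP => P; rewrite /= ?count_cat /= ?count_cat /=; lia.
  - move=> x; rewrite -(perm_mem (s1 :=
    labels (Node z l1 r1) ++ labels l2 ++ labels r2)) //.
    by apply/permP => P; rewrite /= ?count_cat /= ?count_cat /=; lia.
  - by apply: represents_perm rep; rewrite perm_catC.
  - by rewrite inE kl orbT.
  by exists l, r, l', r'.
have [l1' [r1' [l2' [r2' [pa pl]]]]] := reroot l2 r2 erefl kl.
exists l1', r1', l2', r2'; split.
- by rewrite (perm_uniq pl).
- by move=> x; rewrite (perm_mem pl).
- by apply: represents_perm rep; rewrite perm_sym.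
Qed.

Lemma two_sided_mutation (Q : quiver) (z : vertex Q) l1 r1 l2 r2 :
  loop2_free Q -> two_sided z l1 r1 l2 r2 ->
  @two_sided (mutation z) z r1 l2 r2 l1.
Proof.
move=> l2f [u cov rep]; split.
- rewrite -(perm_uniq (s1 := labels (Node z l1 r1) ++ labels l2 ++ labels r2)) //.
  by apply/permP => P; rewrite /= ?count_cat /= ?count_cat /=; lia.
- move=> x; rewrite -(perm_mem (s1 :=
  labels (Node z l1 r1) ++ labels l2 ++ labels r2)) //.
  by apply/permP => P; rewrite /= ?count_cat /= ?count_cat /=; lia.
pose C := tarr l1 ++ tarr r1 ++ tarr l2 ++ tarr r2.
have rep' : represents (tri (Some z) (troot l1) (troot r1) ++
                        tri (Some z) (troot l2) (troot r2) ++ C).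
  apply: represents_perm rep; apply/permP => P;
    rewrite /= ?count_cat /= ?count_cat /=; lia.
suff: @represents (mutation z) (tri (Some z) (troot r1) (troot l2) ++
                        tri (Some z) (troot r2) (troot l1) ++ C).
  apply: represents_perm; apply/permP => P; rewrite /= ?count_cat /= ?count_cat /=; lia.
move/uniq_countP: u => u.
(* Each surviving arrow lies inside one of four disjoint subtrees, so it avoids [z] and never joins
   the roots of two of them. *)
have CE p q : (p, q) \in C -> [|| (p \in labels l1) && (q \in labels l1),
    (p \in labels r1) && (q \in labels r1),  (p \in labels l2) && (q \in labels l2)
     | (p \in labels r2) && (q \in labels r2)].
  by rewrite !mem_cat => /or4P[] /tarr_labels ->; rewrite ?orbT.
apply: flip_represents => //.
- apply: (@subseq_uniq _ _ (labels (Node z l1 r1) ++ labels l2 ++ labels r2)).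
    have sc s s' : subseq s s' -> subseq (z :: s) (z :: s') by rewrite /= eqxx.
    rewrite [labels _]/= cat_cons; apply: sc; rewrite -catA -[labels r2]cats0.
    by do 4! apply: subseq_troot.
  by apply/uniq_countP.
- move=> p q /CE h; apply/andP; split; apply/eqP => ez; move: h (u z).
    by rewrite ez !mem_count /= !count_cat eqxx => /or4P[] /andP[]; lia.
  by rewrite ez !mem_count /= !count_cat eqxx => /or4P[] /andP[]; lia.
- move=> x y /mem_troot xl /mem_troot yr; apply/negP => /CE.
  move: (u x) (u y) xl yr; rewrite !mem_count /= !count_cat.
  by move=> ? ? ? ? /or4P[] /andP[]; lia.
- move=> x y /mem_troot xl /mem_troot yr; apply/negP => /CE.
  move: (u x) (u y) xl yr; rewrite !mem_count /= !count_cat.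
  by move=> ? ? ? ? /or4P[] /andP[]; lia.
Qed.

Lemma tree_like_mutation (Q : quiver) (k : vertex Q) :
  loop2_free Q -> tree_like Q -> tree_like (mutation k).
Proof.
move=> l2 /(two_sided_reroot k)[l1 [r1 [l2' [r2 tw]]]].
by exists k, r1, l2', r2, l1; apply: two_sided_mutation.
Qed.

Fixpoint map_tree (V W : Type) (f : V -> W) (t : tree V) : tree W :=
  if t is Node x l r then Node (f x) (map_tree f l) (map_tree f r) else Leaf.

Lemma labels_map (V W : eqType) (f : V -> W) t :
  labels (map_tree f t) = map f (labels t).
Proof. by elim: t => //= x l -> r ->; rewrite map_cat. Qed.

Lemma troot_map (V W : eqType) (f : V -> W) t :
  troot (map_tree f t) = omap f (troot t).
Proof. by case: t. Qed.

Definition map_pair (V W : Type) (f : V -> W) (e : V * V) := (f e.1, f e.2).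

Lemma arr_map (V W : eqType) (f : V -> W) a b :
  arr (omap f a) (omap f b) = map (map_pair f) (arr a b).
Proof. by case: a b => [x|] [y|]. Qed.

Lemma tarr_map (V W : eqType) (f : V -> W) t :
  tarr (map_tree f t) = map (map_pair f) (tarr t).
Proof.
elim: t => //= x l -> r ->; rewrite /tri !map_cat -!arr_map !troot_map.
by rewrite -!catA.
Qed.

Lemma map_pair_inj (V W : eqType) (f : V -> W) : injective f -> injective (map_pair f).
Proof. by move=> fi [a b] [c d] [/fi -> /fi ->]. Qed.

Lemma represents_map (Q Q' : quiver) (f : vertex Q -> vertex Q') E : bijective f ->
  (forall p q, adj (f p) (f q) = adj p q) -> represents E ->
  represents (map (map_pair f) E).
Proof.
case=> g fK gK fadj rE p q; rewrite -(gK p) -(gK q) fadj rE count_map.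
by apply: eq_count => e /=;
  rewrite -[(f _, f _)]/(map_pair f (g p, g q)) (inj_eq (map_pair_inj (can_inj fK))).
Qed.

Lemma tree_like_bij (Q Q' : quiver) (f : vertex Q -> vertex Q') : bijective f ->
  (forall p q, adj (f p) (f q) = adj p q) -> tree_like Q -> tree_like Q'.
Proof.
move=> bf fadj [z [l1 [r1 [l2 [r2 [u cov rep]]]]]].
exists (f z), (map_tree f l1), (map_tree f r1), (map_tree f l2), (map_tree f r2).
have e : labels (map_tree f (Node z l1 r1)) ++ labels (map_tree f l2) ++
   labels (map_tree f r2) = map f (labels (Node z l1 r1) ++ labels l2 ++ labels r2).
  by rewrite !labels_map !map_cat.
rewrite /two_sided -[Node _ _ (map_tree f r1)]/(map_tree f (Node z l1 r1)).
rewrite -[Node _ _ (map_tree f r2)]/(map_tree f (Node z l2 r2)) e; split.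
- by rewrite map_inj_uniq //; apply: bij_inj.
- by case: bf => g fK gK x; rewrite -(gK x); apply: map_f.
by rewrite !tarr_map -map_cat; apply: represents_map.
Qed.

(** For the backward implication a step is undone by mutating again at [k], which gives back the
    arrow counts of [Q]. *)
Lemma tree_like_reachable (Q Q' : quiver) :
  mutation_reachable Q Q' -> (tree_like Q <-> tree_like Q').
Proof.
elim=> {Q Q'} [Q Q' /isomorphicP[f [g fK gK] fadj]|Q Q' k l2 _ IH].
  split; apply: tree_like_bij; [by exists g|by []|by exists f|].
  by move=> p q; rewrite -fadj !gK.
rewrite -IH; split; first exact: tree_like_mutation.
move=> /(@tree_like_mutation (mutation k) k) tl.
apply: (tree_like_bij (f := fun x : vertex (@mutation (mutation k) k) => (x : vertex Q))).
- by exists id.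
- by move=> p q; rewrite adj_mutationK.
by apply: tl; apply: loop2_free_mutation.
Qed.

Definition ends (Q : quiver) (a : arrow Q) : vertex Q * vertex Q := (src a, tgt a).

Definition arcs (Q : quiver) (A : {set arrow Q}) := [seq ends a | a <- enum A].

Lemma card_setI_count (T : finType) (A : {set T}) (P : pred T) :
  #|[set a in A | P a]| = count P (enum A).
Proof.
rewrite -size_filter -(card_uniqP (filter_uniq _ (enum_uniq _))).
by apply: eq_card => a; rewrite !inE mem_filter mem_enum andbC.
Qed.

Lemma count_arcs (Q : quiver) (A : {set arrow Q}) p q :
  count_mem (p, q) (arcs A) = #|A :&: arrows p q|.
Proof.
rewrite count_map -card_setI_count; apply: eq_card => a.
by rewrite !inE.
Qed.

Lemma mem_set3 (T : finType) (x y w d : T) : (d \in [set x; y;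
  w]) = [|| d == x, d == y | d == w].
Proof. by rewrite !in_setU !in_set1 orbA. Qed.

Lemma perm_count_mem (T : eqType) (s1 s2 : seq T) :
  (forall x, count_mem x s1 = count_mem x s2) -> perm_eq s1 s2.
Proof. by move=> e; apply/allP => x _; apply/eqP/e. Qed.

Lemma representsP (Q : quiver) E :
  represents E <-> perm_eq (arcs [set: arrow Q]) E.
Proof.
split=> [rE|/permP pE p q].
  by apply: perm_count_mem => -[p q]; rewrite count_arcs setTI [LHS]rE.
by rewrite -pE count_arcs setTI.
Qed.

(** In [tarr] an arrow leaves a node towards its left child and enters it from its right child, so
    an oriented path is a tree with at most one child per node, whose side records the direction. *)
Fixpoint chain (V : Type) (o : nat -> bool) (f : nat -> V) (j n : nat) : tree V :=
  if n is n'.+1 then let t := chain o f j.+1 n' in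
    if o j then Node (f j) t Leaf else Node (f j) Leaf t
  else Leaf.

Lemma labels_chain (V : eqType) o (f : nat -> V) j n :
  labels (chain o f j n) = [seq f i | i <- iota j n].
Proof.
by elim: n j => //= n IH j; case: (o j); rewrite /= ?cats0 IH.
Qed.

Lemma tarr_chain (V : eqType) o (f : nat -> V) j n :
  tarr (chain o f j n.+1) =
  [seq if o i then (f i, f i.+1) else (f i.+1, f i) | i <- iota j n].
Proof.
elim: n j => [|n IH] j; first by rewrite /=; case: (o j).
rewrite [iota _ _]/= [map _ (j :: _)]/= -IH [LHS]/=.
by case: (o j); rewrite /= ?cats0; case: (o j.+1); rewrite /= ?cats0.
Qed.

Lemma tree_like_dynkin k (o : 'I_k -> bool) : tree_like (dynkin_A o).
Proof.
(* [chain] expects an orientation indexed by [nat]. The last vertex consults [o' k], but with no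
   vertex left both choices give two leaves. *)
pose o' i := [exists a : 'I_k, (a == i :> nat) && o a].
have o'E (a : 'I_k) : o' a = o a.
  apply/existsP/idP => [[b /andP[/eqP/val_inj -> //]]|oa].
  by exists a; rewrite eqxx.
pose f : nat -> vertex (dynkin_A o) := @inord k.
suff tw t : labels t = [seq f i | i <- iota 0 k.+1] ->
    tarr t = [seq if o' i then (f i, f i.+1) else (f i.+1, f i) | i <- iota 0 k] ->
    tree_like (dynkin_A o).
  by apply: (tw (chain o' f 0 k.+1)); rewrite ?labels_chain ?tarr_chain.
have eV : [seq f i | i <- iota 0 k.+1] = enum 'I_k.+1.
  rewrite -val_enum_ord -map_comp -[RHS]map_id; apply: eq_map => i /=.
  exact: inord_val.
case: t => // z l r el ea; exists z, l, r, Leaf, Leaf; split.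
- by rewrite cats0 el eV enum_uniq.
- by move=> x; rewrite cats0 el eV mem_enum.
rewrite cats0 ea; apply/representsP; rewrite -val_enum_ord -map_comp.
rewrite /arcs enum_setT -enumT; apply/seq.permP => P; congr count.
apply: eq_map => a /=; rewrite o'E /ends /=.
have -> : f a = widen_ord (leqnSn k) a.
  by apply: val_inj; rewrite /f /= inordK // ltnS ltnW.
have -> : f a.+1 = lift ord0 a.
  by apply: val_inj; rewrite /f /= inordK // ltnS.
by case: (o a).
Qed.

Lemma type_A_tree_like (Q : quiver) : type_A Q -> tree_like Q.
Proof.
case=> k [o [re|re]]; first by rewrite (tree_like_reachable re); apply: tree_like_dynkin.
by rewrite -(tree_like_reachable re); apply: tree_like_dynkin.
Qed.

Lemma full_subquiver_tree (Q : quiver) (S : {set vertex Q}) (z : vertex Q) :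
  z \in S -> type_A (full_subquiver S) ->
  exists l1 r1 l2 r2, [/\ uniq (labels (Node z l1 r1) ++ labels l2 ++ labels r2),
    labels (Node z l1 r1) ++ labels l2 ++ labels r2 =i S &
    perm_eq (arcs (arrows_in S)) (tarr (Node z l1 r1) ++ tarr (Node z l2 r2))].
Proof.
move=> zS /type_A_tree_like/(@two_sided_reroot (full_subquiver S) (exist _ z zS)).
case=> l1 [r1 [l2 [r2 [u cov /representsP rep]]]].
pose f : vertex (full_subquiver S) -> vertex Q := val.
exists (map_tree f l1), (map_tree f r1), (map_tree f l2), (map_tree f r2).
rewrite -[Node _ _ (map_tree f r1)]/(map_tree f (Node (exist _ z zS) l1 r1)).
rewrite -[Node _ _ (map_tree f r2)]/(map_tree f (Node (exist _ z zS) l2 r2)).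
rewrite !labels_map !tarr_map -!map_cat; split.
- by rewrite map_inj_uniq //; apply: val_inj.
- move=> x; apply/mapP/idP => [[y _ ->]|xS]; first exact: valP.
  by exists (exist _ x xS).
apply: perm_trans (perm_map _ rep).
rewrite /arcs -map_comp.
have -> : map (map_pair f \o @ends (full_subquiver S)) (enum [set:
  arrow (full_subquiver S)]) =
  map (@ends Q) (map val (enum [set: arrow (full_subquiver S)])).
  by rewrite -map_comp.
apply/perm_map/uniq_perm; rewrite ?enum_uniq //.
  by rewrite map_inj_uniq ?enum_uniq //; apply: val_inj.
move=> a; rewrite mem_enum; apply/idP/mapP => [aS|[b _ ->]]; last exact: valP.
by exists (exist _ a aS) => //; rewrite mem_enum inE.
Qed.

(** Every child of [z], on either side, contributes an incident arrow. If both sides had a child,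
    there would be exactly two incident arrows, hence a 3-cycle z -> p -> q -> z, with p a left
    child and q a right child of [z]. If these are on one side, the other side provides a third
    incident arrow; if they are on different sides, no arrow leads from p to q. *)
Lemma branch_tree (Q : quiver) (S : {set vertex Q}) (z : vertex Q)
    (inc := [set a in arrows_in S | incident a z]) :
  z \in S -> type_A (full_subquiver S) -> #|inc| <= 2 ->
  (#|inc| = 2 -> exists2 T, T \in triangles Q &
     T \subset arrows_in S /\ exists2 a, a \in T & src a = z) ->
  exists l r, [/\ uniq (labels (Node z l r)), labels (Node z l r) =i S &
    perm_eq (arcs (arrows_in S)) (tarr (Node z l r))].
Proof.
move=> zS tA inc2 tri2.
have [l1 [r1 [l2 [r2 [u cov pE]]]]] := full_subquiver_tree zS tA.
have : #|inc| = count [pred e | (e.1 == z) || (e.2 == z)] (arcs (arrows_in S)).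
  by rewrite count_map -card_setI_count; apply: eq_card => a; rewrite !inE.
rewrite (seq.permP pE) => cinc.
have tri_ge l r : isSome (troot l) + isSome (troot r) <=
    count [pred e | (e.1 == z) || (e.2 == z)] (tarr (Node z l r)).
  rewrite [tarr _]/= count_cat; apply: leq_trans (leq_addr _ _).
  case: (troot l) => [x|]; case: (troot r) => [y|] /=; rewrite ?eqxx ?orbT /= ?addn0 //.
  by case: (_ || _).
have inc_ge : isSome (troot l1) + isSome (troot r1) +
    (isSome (troot l2) + isSome (troot r2)) <= #|inc|.
  by rewrite cinc count_cat leq_add.
have [e1|n1] := boolP (~~ isSome (troot l1) && ~~ isSome (troot r1)).
  exists l2, r2; case: l1 r1 e1 u cov pE {inc_ge cinc} => [|? ? ?] [|? ? ?] //= _.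
have [e2|n2] := boolP (~~ isSome (troot l2) && ~~ isSome (troot r2)).
  exists l1, r1; case: l2 r2 e2 u cov pE {inc_ge cinc} => [|? ? ?] [|? ? ?] //= _.
  by rewrite /= !cats0 => *; split.
have /tri2[T] : #|inc| = 2.
  apply/eqP; rewrite eqn_leq inc2 (leq_trans _ inc_ge) //.
  by case: (troot l1) (troot r1) (troot l2) (troot r2) n1 n2 => [?|] [?|] [?|] [?|].
rewrite inE => /existsP[a /existsP[b /existsP[c /andP[/and4P[_ /eqP ab /eqP bc /eqP ca] /eqP ->]]]].
case=> /subsetP sub [d dT dz].
have E x : x \in [set a; b; c] -> ends x \in tarr (Node z l1 r1) ++ tarr (Node z l2 r2).
  by move=> /sub xS; rewrite -(perm_mem pE) map_f // mem_enum.
have [p [q [zp pq qz]]] : exists p q,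
  [/\ (z, p) \in tarr (Node z l1 r1) ++ tarr (Node z l2 r2),
      (p, q) \in tarr (Node z l1 r1) ++ tarr (Node z l2 r2) &
      (q, z) \in tarr (Node z l1 r1) ++ tarr (Node z l2 r2)].
  move: dT (E a) (E b) (E c);
    rewrite !inE !eqxx !orbT /ends ab bc ca => dT /(_ isT) Ea /(_ isT) Eb /(_ isT) Ec.
  case/orP: dT => [/orP[]|] /eqP e; rewrite -e dz in Ea Eb Ec.
  - by exists (src b), (src c); split.
  - by exists (src c), (src a); split.
  - by exists (src a), (src b); split.
have nz : [/\ z \notin labels l1, z \notin labels r1, z \notin labels l2 & z \notin labels r2].
  by move: u; rewrite /= !mem_cat !negb_or -!andbA => /and5P[-> -> -> ->].
have dis x : x \in labels (Node z l1 r1) -> x \in labels (Node z l2 r2) -> x = z.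
  rewrite [_ \in labels (Node z l2 r2)]inE => x1 /predU1P[//|x2].
  by move: u; rewrite cat_uniq => /and3P[_ /hasPn/(_ x x2)]; rewrite /= x1.
case: nz => nl1 nr1 nl2 nr2.
have nt t p' q' : z \notin labels t -> (p', q') \in tarr t -> (p' != z) && (q' != z).
  by move=> nt /tarr_labels/andP[pt qt]; apply/andP; split; apply: contraNneq nt => <-.
have nrt t : z \notin labels t -> (troot t == Some z) = false.
  by move=> nt'; apply/eqP => /mem_troot; apply/negP.
(* Arrows out of [z] end at a left child and arrows into [z] start at a right child. *)
have {}zp : (troot l1 == Some p) || (troot l2 == Some p).
  move: zp; rewrite /= !(mem_cat, mem_arr) !nrt // eqxx /=.
  have nt0 t : z \notin labels t -> (z, p) \in tarr t = false.
    by move=> /nt H; apply/negP => /H; rewrite eqxx.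
  by rewrite !nt0 // !orbF.
have {}qz : (troot r1 == Some q) || (troot r2 == Some q).
  move: qz; rewrite /= !(mem_cat, mem_arr) !nrt // eqxx /= !andbT.
  have nt0 t : z \notin labels t -> (q, z) \in tarr t = false.
    by move=> /nt H; apply/negP => /H; rewrite eqxx andbF.
  by rewrite !nt0 // ?andbF ?orbF /=.
have cross l r l' r' : z \notin labels l -> z \notin labels r' ->
    (forall x, x \in labels (Node z l r) -> x \in labels (Node z l' r') -> x = z) ->
    troot l = Some p -> troot r' = Some q ->
    (p, q) \in tarr (Node z l r) ++ tarr (Node z l' r') -> False.
  move=> zl zr {}dis /mem_troot pl /mem_troot qr; rewrite mem_cat.
  case/orP=> /tarr_labels /andP[pt qt].
    suff e : q = z by rewrite e (negPf zr) in qr.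
    by apply: dis; rewrite // inE mem_cat qr !orbT.
  suff e : p = z by rewrite e (negPf zl) in pl.
  by apply: dis; rewrite // inE mem_cat pl !orbT.
have three o1 o2 : ~~ (~~ isSome o1 && ~~ isSome o2) -> 0 < isSome o1 + isSome o2.
  by case: o1; case: o2.
case/orP: zp => /eqP ep; case/orP: qz => /eqP eq.
- have := leq_trans inc_ge inc2; rewrite ep eq.
  by have := three _ _ _ _ n2; case: (_ + _).
- by case: (cross l1 r1 l2 r2).
- case: (cross l2 r2 l1 r1) => //; last by rewrite mem_cat orbC -mem_cat.
  by move=> x x2 x1; apply: dis.
- have := leq_trans inc_ge inc2; rewrite ep eq.
  by have := three _ _ _ _ n1; case: (troot l1); case: (troot r1).
Qed.

(** * Counting 3-cycles in a tree *)

(** For the blocks [trilist] of a tree this says that distinct 3-cycles share no arrow. Nonempty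
    blocks are required because a repeated index shows up only through a repeated entry. *)
Lemma uniq_flatten_map (S T : eqType) (F : S -> seq T) (s : seq S) :
  (forall x, F x != [::]) -> uniq (flatten (map F s)) ->
  uniq s /\ forall x y e, x \in s -> y \in s -> e \in F x -> e \in F y -> x = y.
Proof.
move=> F0; elim: s => //= x s IH; rewrite cat_uniq => /and3P[_ /hasPn d /IH[us inj]].
have dx y e : y \in s -> e \in F y -> e \in F x -> False.
  move=> ys ey ex; have /negP : e \notin F x.
    by apply: d; apply/flattenP; exists (F y); rewrite ?map_f.
  by [].
split; first rewrite us andbT.
  apply/negP => xs; case E: (F x) (F0 x) => [//|e s'] _.
  by apply: (dx x e xs); rewrite E mem_head.
move=> y y' e; rewrite !inE => /predU1P[->|ys] /predU1P[->|ys'] // ey ey'.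
- by case: (dx _ _ ys' ey' ey).
- by case: (dx _ _ ys ey ey').
exact: inj ey ey'.
Qed.

Section TreeTriangles.
Variable V : eqType.
Implicit Types (t l r : tree V).

Definition trilist (y : V * V * V) : seq (V * V) :=
  [:: (y.1.1, y.1.2); (y.1.2, y.2); (y.2, y.1.1)].

Fixpoint tris t : seq (V * V * V) :=
  if t is Node x l r then
    (if (troot l, troot r) is (Some y, Some w) then [:: (x, y, w)] else [::])
      ++ tris l ++ tris r
  else [::].

Fixpoint singles t : seq (V * V) :=
  if t is Node x l r then
    (if troot l && troot r then [::] else tri (Some x) (troot l) (troot r))
      ++ singles l ++ singles r
  else [::].

(* As [tarr t] is duplicate free, the triangles are pairwise disjoint. *)
Lemma tarr_split t : perm_eq (tarr t) (flatten (map trilist (tris t)) ++ singles t).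
Proof.
elim: t => //= x l /seq.permP IHl r /seq.permP IHr; apply/seq.permP => P.
rewrite !count_cat IHl IHr !map_cat !flatten_cat !count_cat.
by case: (troot l) => [y|]; case: (troot r) => [w|]; rewrite /= ?count_cat /=; lia.
Qed.

(** The nodes other than the root are counted through their parents: an only child gives one arrow
    of [singles], two siblings give one 3-cycle, whence the factor 2. The term [isSome] counts the
    root. *)
Lemma size_singles t :
  size (singles t) + 2 * size (tris t) + isSome (troot t) = size (labels t).
Proof.
elim: t => //= x l IHl r IHr; rewrite !size_cat -IHl -IHr; clear.
by case: (troot l) => [y|]; case: (troot r) => [w|]; rewrite /= ?size_cat /=; lia.
Qed.

Lemma uniq_tarr t : uniq (labels t) -> uniq (tarr t).
Proof.
elim: t => //= x l IHl r IHr /andP[].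
rewrite mem_cat negb_or cat_uniq => /andP[xl xr] /and3P[/IHl ul /hasPn lr /IHr ur].
have nl p : p \in labels l -> p \in labels r -> False by move=> pl /lr; rewrite /= pl.
rewrite cat_uniq [uniq (tarr l ++ _)]cat_uniq ul ur andbT /=; apply/and3P; split.
- rewrite /tri; case: (troot l) (@mem_troot _ l) => [y|];
  case: (troot r) (@mem_troot _ r) => [w|] //=.
  move=> /(_ w erefl) wr /(_ y erefl) yl; rewrite !inE !xpair_eqE.
  have xy : x != y by apply: contraNneq xl => ->.
  have xw : x != w by apply: contraNneq xr => ->.
  have yw : y != w by apply/eqP => e; apply: (nl y yl); rewrite e.
  by rewrite (negPf xy) (negPf xw) (negPf yw) ![w == _]eq_sym ?(negPf xw) ?(negPf yw).
- apply/hasPn => -[p q]; rewrite mem_cat mem_tri => h; apply/negP.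
  case/or3P => /andP[/eqP ep /eqP eq]; case/orP: h => /tarr_labels/andP[hp hq].
  + by case: ep => ep; rewrite -ep (negPf xl) in hp.
  + by case: ep => ep; rewrite -ep (negPf xr) in hp.
  + by move/mem_troot: eq => /nl; apply.
  + by move/mem_troot: ep => /nl; apply.
  + by case: eq => eq; rewrite -eq (negPf xl) in hq.
  + by case: eq => eq; rewrite -eq (negPf xr) in hq.
apply/hasPn => -[p q] /tarr_labels/andP[hp hq]; apply/negP => /tarr_labels/andP[hp' _].
exact: nl hp' hp.
Qed.

Lemma tris_uniq t x y w : uniq (labels t) -> (x, y, w) \in tris t -> uniq [:: x; y; w].
Proof.
elim: t => //= x' l IHl r IHr /andP[].
rewrite mem_cat negb_or cat_uniq => /andP[xl xr] /and3P[/IHl ul /hasPn lr /IHr ur].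
rewrite !mem_cat => /or3P[|/ul|/ur] //.
case: (troot l) (@mem_troot _ l) => [y'|//];
  case: (troot r) (@mem_troot _ r) => [w'|//] /=.
move=> /(_ w' erefl) wr /(_ y' erefl) yl; rewrite !inE => /eqP[-> -> ->].
rewrite !negb_or andbT; apply/andP; split; first (apply/andP; split).
- by apply: contraNneq xl => ->.
- by apply: contraNneq xr => ->.
- by have := lr _ wr; rewrite /= => h; apply: contraNneq h => <-.
Qed.

(** The root has no out-neighbour but its left child and no in-neighbour but its right child, so a
    3-cycle through it is the expected one. A 3-cycle avoiding it stays in one subtree: the only
    arrow between the subtrees goes from left to right, and nothing returns. *)
Lemma tarr_triangle t p q w : uniq (labels t) ->
  (p, q) \in tarr t -> (q, w) \in tarr t -> (w, p) \in tarr t ->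
  exists2 y, y \in tris t & y \in [:: (p, q, w); (q, w, p); (w, p, q)].
Proof.
elim: t => // x l IHl r IHr; rewrite [uniq _]/= => /andP[].
rewrite mem_cat negb_or cat_uniq => /andP[xl xr] /and3P[/IHl{}IHl /hasPn lr /IHr{}IHr].
have nl a : a \in labels l -> a \in labels r -> False by move=> al /lr; rewrite /= al.
have out a : (x, a) \in tarr (Node x l r) -> troot l = Some a.
  rewrite /= !mem_cat !mem_arr -!orbA => /orP[/andP[_ /eqP //]|].
  case/or4P=> [/andP[/eqP/mem_troot]|/andP[/eqP/mem_troot]|/tarr_labels/andP[]|
    /tarr_labels/andP[]];
    by rewrite ?(negPf xl) ?(negPf xr).
have inn a : (a, x) \in tarr (Node x l r) -> troot r = Some a.
  rewrite /= !mem_cat !mem_arr -!orbA =>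
    /or4P[/andP[_ /eqP/mem_troot]|/andP[_ /eqP/mem_troot]|/andP[/eqP //]|
      /orP[]/tarr_labels/andP[_]];
    by rewrite ?(negPf xl) ?(negPf xr).
have root3 a b : (x, a) \in tarr (Node x l r) -> (b, x) \in tarr (Node x l r) ->
    (x, a, b) \in tris (Node x l r).
  by move=> /out ea /inn eb; rewrite /= ea eb mem_head.
move=> pq qw wp.
have [ep|np] := eqVneq p x.
  subst p; exists (x, q, w); last by rewrite !inE eqxx.
  exact: root3.
have [eq|nq] := eqVneq q x.
  subst q; exists (x, w, p); last by rewrite !inE eqxx orbT.
  exact: root3.
have [ew|nw] := eqVneq w x.
  subst w; exists (x, p, q); last by rewrite !inE eqxx !orbT.
  exact: root3.
have step a b : a != x -> b != x -> (a, b) \in tarr (Node x l r) ->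
    [\/ (a, b) \in tarr l, (a, b) \in tarr r | a \in labels l /\ b \in labels r].
  move=> na nb; rewrite /= !mem_cat !mem_arr -!orbA =>
    /or4P[/andP[/eqP[e]]|/andP[/eqP/mem_troot ? /eqP/mem_troot ?]|/andP[_ /eqP[e]]|
      /orP[]] //.
  - by rewrite e eqxx in na.
  - by constructor 3.
  - by rewrite e eqxx in nb.
  - by constructor 1.
  - by constructor 2.
have fin : (exists2 y, y \in tris l & y \in [:: (p, q, w); (q, w, p); (w, p, q)]) \/
   (exists2 y, y \in tris r & y \in [:: (p, q, w); (q, w, p); (w, p, q)]).
  case: (step _ _ np nq pq) => [pq'|pq'|[pl qr]];
  case: (step _ _ nq nw qw) => [qw'|qw'|[ql wr]];
  case: (step _ _ nw np wp) => [wp'|wp'|[wl pr]]; auto; exfalso;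
  repeat match goal with H : is_true ((_, _) \in tarr _) |- _ =>
    move/tarr_labels/andP: H => [] ? ? end;
  match goal with H : is_true (?a \in labels l) , H' : is_true (?a \in labels r) |- _ =>
    exact: nl H H' end.
by case: fin => [[y]|[y]] yt yin; exists y; rewrite //= !mem_cat yt ?orbT.
Qed.

End TreeTriangles.

(** This carries [size_singles] over to arrows of [Q]. A tree has no multiple arrows, so [ends] is
    injective on [arrows_in S], and the 3-cycles in [S], as sets of arrows, correspond to the
    triples in [tris]. The final 1 is the root. *)
Lemma tree_params (Q : quiver) (S : {set vertex Q}) z l r
    (TS := [set T in triangles Q | T \subset arrows_in S]) :
  uniq (labels (Node z l r)) -> labels (Node z l r) =i S ->
  perm_eq (arcs (arrows_in S)) (tarr (Node z l r)) ->
  #|arrows_in S :\: cover TS| + 2 * #|TS| + 1 = #|S|.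
Proof.
set t := Node z l r => u cov pE.
have -> : #|S| = size (labels t).
  by rewrite -(card_uniqP u); apply: eq_card => x; rewrite cov.
rewrite -size_singles -[isSome _]/true.
have ut := uniq_tarr u.
have usplit : uniq (flatten (map (@trilist _) (tris t)) ++ singles t).
  by rewrite -(perm_uniq (tarr_split t)).
have uarcs : uniq (arcs (arrows_in S)) by rewrite (perm_uniq pE).
have einj : {in arrows_in S &, injective (@ends Q)}.
  move=> a b aS bS eab; have ai : a \in enum (arrows_in S) by rewrite mem_enum.
  have bi : b \in enum (arrows_in S) by rewrite mem_enum.
  rewrite -(nth_index a ai) -(nth_index a bi).
  congr nth; apply/eqP; rewrite -(nth_uniq (ends a) _ _ uarcs) ?size_map ?index_mem //.
  by rewrite !(nth_map a) ?index_mem // !nth_index // eab.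
have memt a : a \in arrows_in S -> ends a \in tarr t.
  by move=> aS; rewrite -(perm_mem pE) map_f // mem_enum.
have memS e : e \in tarr t -> exists2 a, a \in arrows_in S & ends a = e.
  by rewrite -(perm_mem pE) => /mapP[a]; rewrite mem_enum => aS ->; exists a.
pose trset y := [set a in arrows_in S | ends a \in trilist y].
have memtr y d : (d \in trset y) = (d \in arrows_in S) && (ends d \in trilist y).
  by rewrite [LHS]inE.
have mem3 (x y w d : arrow Q) : (d \in [set x; y; w]) = (d \in [:: x; y; w]).
  by rewrite mem_set3 !inE.
have tri_sub y e : y \in tris t -> e \in trilist y -> e \in tarr t.
  move=> yt ey; rewrite (perm_mem (tarr_split t)) mem_cat; apply/orP; left.
  by apply/flattenP; exists (trilist y); rewrite ?map_f.
have [utris itris] : uniq (tris t) /\ forall x y e, x \in tris t -> y \in tris t ->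
    e \in trilist x -> e \in trilist y -> x = y.
  by apply: uniq_flatten_map => //; move: usplit; rewrite cat_uniq => /and3P[].
have TSE : TS = [set T in map trset (tris t)].
  apply/setP => T; rewrite !inE; apply/andP/mapP => [[]|[[[x y] w] yt ->]].
    case/existsP=> a /existsP[b /existsP[c /andP[/and4P[_ /eqP ab /eqP bc /eqP ca] /eqP ->]]].
    move=> /subsetP sub.
    have aS : a \in arrows_in S by apply: sub; rewrite !inE eqxx.
    have bS : b \in arrows_in S by apply: sub; rewrite !inE eqxx orbT.
    have cS : c \in arrows_in S by apply: sub; rewrite !inE eqxx !orbT.
    have [||| y yt yin] := @tarr_triangle _ t (src a) (src b) (src c) u.
    - by rewrite -ab; apply: memt.
    - by rewrite -bc; apply: memt.
    - by rewrite -ca; apply: memt.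
    have ey : trilist y =i [:: ends a; ends b; ends c].
      move: yin; rewrite /ends ab bc ca !inE => /or3P[] /eqP -> e;
        rewrite !inE /=; by case: (e == _); case: (e == _); case: (e == _).
    exists y => //; apply/setP => d; rewrite memtr ey mem3.
    apply/idP/andP => [|[dS]].
      by rewrite inE [_ \in [:: b; c]]inE mem_seq1; case/or3P=> /eqP ->; split;
        rewrite // !inE eqxx ?orbT.
    rewrite !inE; case/or3P=> /eqP/einj => /(_ dS);
      [move=> /(_ aS)|move=> /(_ bS)|move=> /(_ cS)] => ->;
      by rewrite eqxx ?orbT.
  split; last by apply/subsetP => a; rewrite !inE => /andP[].
  have [a aS ea] := memS (x, y) (tri_sub _ _ yt (mem_head _ _)).
  have [b bS eb] : exists2 a, a \in arrows_in S & ends a = (y, w).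
    by apply: memS; apply: tri_sub yt _; rewrite !inE eqxx orbT.
  have [c cS ec] : exists2 a, a \in arrows_in S & ends a = (w, x).
    by apply: memS; apply: tri_sub yt _; rewrite !inE eqxx !orbT.
  apply/existsP; exists a; apply/existsP; exists b; apply/existsP; exists c.
  have [[[sa ta] [sb tb]] [sc tc]] := (ea, eb, ec).
  apply/andP; split.
    by rewrite /oriented_3cycle sa ta sb tb sc tc !eqxx (tris_uniq u yt).
  apply/eqP/setP => d; rewrite memtr mem3.
  rewrite /trilist /= -ea -eb -ec; apply/andP/idP => [[dS]|].
    rewrite !inE; case/or3P=> /eqP/einj => /(_ dS);
      [move=> /(_ aS)|move=> /(_ bS)|move=> /(_ cS)] => ->;
      by rewrite eqxx ?orbT.
  by rewrite inE [_ \in [:: b; c]]inE mem_seq1; case/or3P=> /eqP ->; split;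
    rewrite // !inE eqxx ?orbT.
have -> : #|TS| = size (tris t).
  rewrite TSE -(size_map trset) -(card_uniqP _); first by apply: eq_card => T;
    rewrite inE.
  rewrite map_inj_in_uniq // => y y' yt yt' /setP e.
  have e1 : (y.1.1, y.1.2) \in trilist y by rewrite mem_head.
  have [a aS ea] := memS _ (tri_sub _ _ yt e1).
  have := e a; rewrite !memtr !ea aS e1 /= => /esym e2.
  exact: itris e1 e2.
congr (_ + _ + _).
have ss e : e \in tarr t -> (e \in flatten (map (@trilist _) (tris t))) = (e \notin singles t).
  rewrite (perm_mem (tarr_split t)) mem_cat; case/orP=> h.
    rewrite h; apply/esym/negP => h'.
    by move: usplit; rewrite cat_uniq => /and3P[_ /hasPn/(_ e h')]; rewrite /= h.
  rewrite h; apply/negbTE.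
  by move: usplit; rewrite cat_uniq => /and3P[_ /hasPn/(_ e h)].
have -> : arrows_in S :\: cover TS = [set a in arrows_in S | ends a \in singles t].
  apply/setP => a; rewrite in_setD [RHS]in_set andbC; case: (boolP (a \in _)) => //= aS.
  rewrite -[RHS]negbK -(ss _ (memt a aS)); congr negb.
  rewrite /cover TSE; apply/bigcupP/flattenP => [[T]|[s /mapP[y yt ->] ay]].
    rewrite in_set => /mapP[y yt ->]; rewrite memtr => /andP[_ ay].
    by exists (trilist y); rewrite ?map_f.
  by exists (trset y); [rewrite in_set map_f|rewrite memtr aS].
rewrite card_setI_count -(count_map (@ends Q) (mem (singles t))) -/(arcs _).
rewrite (seq.permP pE) (seq.permP (tarr_split t)) count_cat.
have /eqP -> : count (mem (singles t)) (singles t) == size (singles t).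
  by rewrite -all_count; apply/allP.
move: usplit; rewrite cat_uniq => /and3P[_ h _].
rewrite (_ : count _ _ = 0) //; apply/eqP; rewrite -leqn0 leqNgt -has_count.
apply: contra h => /hasP[e e1 e2]; apply/hasP; by exists e.
Qed.

(** * Cycles with hanging trees *)

Section Segments.
Variable V : eqType.

(* An arrow of the non-oriented cycle between [start] and the start of the next
   segment, clockwise if [dir] holds, with the tree hanging from it. *)
Record segment := Segment { dir : bool; start : V; apex : tree V }.
Implicit Types (s : seq segment) (g : segment).

(** For a [Leaf] apex, [arr] drops the two side arrows and only the cycle arrow remains. *)
Definition seg_arcs (d : bool) (v w : V) (t : tree V) :=
  (if d then tri (troot t) (Some v) (Some w)
   else tri (troot t) (Some w) (Some v)) ++ tarr t.

Definition starts s := map start s.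

(* [e] is the vertex where the last segment ends; for a closed cycle it is the
   start of the first one. *)
Fixpoint cyc_arcs s (e : V) : seq (V * V) :=
  if s is g :: s' then
    seg_arcs (dir g) (start g) (head e (starts s')) (apex g) ++ cyc_arcs s' e
  else [::].

(** The end vertex is left to the next segment, so that the segments of a closed cycle partition the
    vertices. *)
Definition seg_labels g := start g :: labels (apex g).
Definition cyc_labels s := flatten (map seg_labels s).

Definition weight (c : bool) s :=
  \sum_(g <- s) (dir g == c) * size (seg_labels g).

Lemma cyc_arcs_cat s1 s2 e :
  cyc_arcs (s1 ++ s2) e = cyc_arcs s1 (head e (starts s2)) ++ cyc_arcs s2 e.
Proof.
elim: s1 => //= g s1 ->; rewrite catA; congr ((seg_arcs _ _ _ _ ++ _) ++ _).
by case: s1.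
Qed.

Lemma cyc_labels_cat s1 s2 : cyc_labels (s1 ++ s2) = cyc_labels s1 ++ cyc_labels s2.
Proof. by rewrite /cyc_labels map_cat flatten_cat. Qed.

Lemma head_cyc_labels s e : head e (starts s) \in e :: cyc_labels s.
Proof. by case: s => [|g s] /=; rewrite ?mem_head // inE mem_head orbT. Qed.

Lemma seg_arcs_labels d v w t p q : (p, q) \in seg_arcs d v w t ->
  (p \in v :: w :: labels t) && (q \in v :: w :: labels t).
Proof.
have tr a b x y : (x, y) \in tri (troot t) (Some a) (Some b) ->
    (x \in a :: b :: labels t) && (y \in a :: b :: labels t).
  rewrite mem_tri !inE => /or3P[]/andP[].
  - by move=> /eqP/mem_troot -> /eqP[->]; rewrite eqxx ?orbT.
  - by move=> /eqP[->] /eqP[->]; rewrite !eqxx ?orbT.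
  - by move=> /eqP[->] /eqP/mem_troot ->; rewrite !eqxx ?orbT.
rewrite /seg_arcs; case: d; rewrite mem_cat => /orP[/tr|/tarr_labels/andP[pt qt]];
  rewrite ?inE ?pt ?qt ?orbT //.
by move=> /andP[hp hq]; apply/andP; split; rewrite orbCA.
Qed.

Lemma cyc_arcs_labels s e p q : (p, q) \in cyc_arcs s e ->
  (p \in e :: cyc_labels s) && (q \in e :: cyc_labels s).
Proof.
elim: s => //= g s IH; rewrite mem_cat => /orP[/seg_arcs_labels|/IH].
  suff sub x : x \in [:: start g, head e (starts s) & labels (apex g)] ->
     x \in e :: cyc_labels (g :: s) by move=> /andP[/sub -> /sub ->].
  have := head_cyc_labels s e; move: (head _ _) => h; rewrite !inE mem_cat.
  move=> hin /or3P[/eqP ->|/eqP ->|->]; rewrite ?eqxx ?orbT //.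
  by case/orP: hin => ->; rewrite ?orbT.
by case/andP; rewrite !inE !mem_cat => /orP[] -> /orP[] ->; rewrite ?orbT.
Qed.

End Segments.

Lemma isomorphic_sym (Q Q' : quiver) : isomorphic Q Q' -> isomorphic Q' Q.
Proof.
move=> /isomorphicP[f [g fK gK] fadj]; apply/isomorphicP; exists g; first by exists f.
by move=> p q; rewrite -fadj !gK.
Qed.

Definition leafy (V : eqType) (g : segment V) := if apex g is Leaf then true else false.

(** At the last index [i.+1] is out of range, and the default [e] of [nth] provides the end of the
    cycle. *)
Lemma cyc_arcs_leafy (V : eqType) (s : seq (segment V)) e : all (@leafy V) s ->
  cyc_arcs s e = [seq if nth true (map (@dir V) s) i
                      then (nth e (starts s) i, nth e (starts s) i.+1)
                      else (nth e (starts s) i.+1, nth e (starts s) i)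
                 | i <- iota 0 (size s)].
Proof.
elim: s => //= -[d v [|//]] s IH /= /IH ->; rewrite -[1]/(1 + 0) iotaDl -map_comp.
by rewrite nth0; case: d.
Qed.

Lemma cyc_labels_leafy (V : eqType) (s : seq (segment V)) : all (@leafy V) s ->
  cyc_labels s = starts s.
Proof.
by elim: s => //= -[d v [|//]] s IH /= /IH e; rewrite /cyc_labels /= -e.
Qed.

(** The last condition closes the cycle: [e], the end of the last segment, is the start of the
    first. *)
Definition cyclic (Q : quiver) (s : seq (segment (vertex Q))) (e : vertex Q) :=
  [/\ uniq (cyc_labels s), forall x, x \in cyc_labels s,
      represents (cyc_arcs s e) & head e (starts s) = e].

Lemma cyclic_leafy (Q : quiver) n (s : seq (segment (vertex Q))) e :
  all (@leafy _) s -> cyclic s e -> size (cyc_labels s) = n.+1 ->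
  exists2 cw' : 'I_n.+1 -> bool, isomorphic Q (cycle_quiver cw') &
    forall c, #|[set i | cw' i == c]| = weight c s.
Proof.
move=> ls [u cov rep he] sz; have el := cyc_labels_leafy ls.
have ss : size s = n.+1 by rewrite -sz el size_map.
rewrite el in u cov sz.
exists (fun i : 'I_n.+1 => nth true (map (@dir _) s) i).
  apply: isomorphic_sym; apply/isomorphicP.
  set C := cycle_quiver _.
  pose f : vertex C -> vertex Q := fun i : 'I_n.+1 => nth e (starts s) i.
  have finj : injective f.
    by move=> i j /eqP; rewrite nth_uniq ?sz // => /eqP/val_inj.
  have fsur x : exists i, f i = x.
    have xs := cov x; have lt : index x (starts s) < n.+1 by rewrite -sz index_mem.
    by exists (Ordinal lt); rewrite /f /= nth_index.
  have fbij : bijective f.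
    have [h hP] := fin_all_exists fsur.
    by exists h => // i; apply: finj; rewrite hP.
  exists f => // p q; rewrite rep cyc_arcs_leafy // ss.
  have -> : adj p q = count_mem (p, q) (arcs [set: arrow C]).
    by rewrite count_arcs setTI.
  rewrite -[RHS](_ : count_mem (f p, f q) (map (map_pair f) (arcs [set:
    arrow C])) = _); last first.
    rewrite count_map; apply: eq_count => a /=.
    by rewrite -[(f p, _)]/(map_pair f (p, q)) (inj_eq (map_pair_inj finj)).
  congr count; rewrite -val_enum_ord -map_comp /arcs -map_comp.
  rewrite enum_setT -enumT; apply: eq_map => i /=.
  (* For the last [i] the left side is the default [e], which [he] identifies with the first vertex,
     in agreement with the wrap-around of [ordS]. *)
  have -> : nth e (starts s) i.+1 = f (ordS i).
    rewrite /f /=; have [->|ni] := eqVneq i.+1 n.+1.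
      by rewrite modnn nth0 he nth_default ?sz.
    by rewrite modn_small // ltn_neqAle ni ltn_ord.
  by rewrite /ends /map_pair /=; case: (nth _ _ _).
move=> c; rewrite /weight -sum1_card (big_nth (Segment true e Leaf)) ss big_mkord.
rewrite big_mkcond; apply: eq_bigr => i _;
  rewrite inE (nth_map (Segment true e Leaf)) ?ss //.
have := all_nthP (Segment true e Leaf) ls i; rewrite ss => /(_ (ltn_ord i)).
by rewrite /leafy /seg_labels; case: (nth _ _ _) => d v [|//] _ /=; case: eqP.
Qed.

Lemma uniq_cat3_disjoint (T : eqType) (x : T) (a b s : seq T) :
  uniq (a ++ b ++ s) -> x \in a -> x \in s -> False.
Proof.
rewrite cat_uniq => /and3P[_ /hasPn h _] xa xs; have := h x.
by rewrite mem_cat xs orbT /= xa => /(_ isT).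
Qed.

(** The new segments are listed clockwise. For an anti-clockwise arrow x -> y the segment starts at
    y, so [L], which hangs from z -> y, comes first. *)
Definition split_segment (V : eqType) (d : bool) (v z : V) (L R : tree V) :=
  if d then [:: Segment d v R; Segment d z L] else [:: Segment d v L; Segment d z R].

(* Mutating at the root of a hanging tree moves that root onto the cycle and
   distributes its two subtrees over the two segments it creates. *)
Lemma cyclic_mutation (Q : quiver) (s1 s2 : seq (segment (vertex Q))) d v z L R e :
  let s := s1 ++ Segment d v (Node z L R) :: s2 in
  let s' := s1 ++ split_segment d v z L R ++ s2 in
  loop2_free Q -> 1 < size s -> cyclic s e -> @cyclic (mutation z) s' e.
Proof.
move=> s s' l2 s_gt1 [u cov rep he].
pose w := head e (starts s2); pose O := v :: cyc_labels (s1 ++ s2).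
have pl : perm_eq (cyc_labels s) (z :: labels L ++ labels R ++ O).
  apply/seq.permP => P;
    rewrite /s /O !cyc_labels_cat /cyc_labels /= ?count_cat /= ?count_cat /= ?count_cat; lia.
have pl' : perm_eq (cyc_labels s') (z :: labels L ++ labels R ++ O).
  apply/seq.permP => P; rewrite /s' /O !cyc_labels_cat /cyc_labels /split_segment.
  by case: (d); rewrite /= ?count_cat /= ?count_cat /= ?count_cat /=; ring.
have he' : head e (starts s') = e.
  by move: he; rewrite /s /s' /split_segment; case: (s1) => //=; case: (d).
have eO : e \in O.
  move: he; rewrite /s /O; case: (s1) => [|g s3] /= <-; first exact: mem_head.
  by rewrite inE; apply/orP; right; apply: mem_head.
(* Since there are at least two segments, the end [w] of this one is the start of another one, hence
   differs from [v]. *)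
have wO : w \in cyc_labels (s1 ++ s2).
  move: s_gt1 he; rewrite /w /s; case: (s2) => [|g s3] /=; last first.
    by move=> _ _; rewrite cyc_labels_cat mem_cat; apply/orP; right; apply: mem_head.
  by case: (s1) => //= g s3 _ <-; apply: mem_head.
have uO : uniq (z :: labels L ++ labels R ++ O) by rewrite -(perm_uniq pl).
split=> //.
- by rewrite (perm_uniq pl').
- by move=> x; rewrite (perm_mem pl') -(perm_mem pl).
pose C := tarr L ++ tarr R ++ cyc_arcs s1 v ++ cyc_arcs s2 e.
pose x := if d then v else w; pose y := if d then w else v.
have xO : x \in O by rewrite /x /O inE; case: (d); rewrite ?eqxx ?wO ?orbT.
have yO : y \in O by rewrite /y /O inE; case: (d); rewrite ?eqxx ?wO ?orbT.
have rep' : represents (tri (Some z) (troot L) (troot R) ++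
  tri (Some z) (Some x) (Some y) ++ C).
  apply: represents_perm rep; apply/seq.permP => P.
  rewrite /s cyc_arcs_cat /= -/w /seg_arcs /x /y /C.
  by case: (d); rewrite /= ?count_cat /= ?count_cat /=; ring.
suff: @represents (mutation z) (tri (Some z) (troot R) (Some x) ++
  tri (Some z) (Some y) (troot L) ++ C).
  apply: represents_perm; apply/seq.permP => P.
  rewrite /s' !cyc_arcs_cat /split_segment /seg_arcs /x /y /C.
  by case: (d); rewrite /= /seg_arcs /= -/w ?count_cat /= ?count_cat /=; ring.
(* [C] may still join [x] and [y], as for a double arrow. The flip only forbids arrows from the root
   of [L] to [y] and from [x] to the root of [R], and no arrow of [C] passes between [L], [R] and
   [O]. *)
have CO p q : (p, q) \in C -> [\/ (p \in labels L) /\ (q \in labels L),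
     (p \in labels R) /\ (q \in labels R) | p \in O /\ q \in O].
  rewrite !mem_cat => /or4P[/tarr_labels/andP[]|/tarr_labels/andP[]|
    /cyc_arcs_labels/andP[]|/cyc_arcs_labels/andP[]].
  - by constructor 1.
  - by constructor 2.
  - have h a : a \in v :: cyc_labels s1 -> a \in O.
      by rewrite /O !inE cyc_labels_cat mem_cat => /orP[] ->; rewrite ?orbT.
    by move=> /h ? /h ?; constructor 3.
  - have h a : a \in e :: cyc_labels s2 -> a \in O.
      by rewrite inE => /predU1P[-> //|h]; rewrite /O inE cyc_labels_cat mem_cat h !orbT.
    by move=> /h ? /h ?; constructor 3.
move: (uO); rewrite cons_uniq => /andP[];
  rewrite !mem_cat !negb_or => /and3P[zL zR zO] uLRO.
have LO a : a \in labels L -> a \in O -> False by apply: uniq_cat3_disjoint uLRO.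
have RO a : a \in labels R -> a \in O -> False.
  by move=> aR aO; move: uLRO;
    rewrite !cat_uniq => /and3P[_ _ /and3P[_ /hasPn/(_ a aO)]]; rewrite /= aR.
have LR a : a \in labels L -> a \in labels R -> False.
  move=> aL aR; move: uLRO; rewrite cat_uniq => /and3P[_ /hasPn/(_ a)].
  by rewrite mem_cat aR /= aL => /(_ isT).
apply: flip_represents => //.
- suff : uniq (z :: pmap id [:: troot L; troot R; Some v; Some w]).
    rewrite /x /y; case: (d) => //;
      rewrite (perm_uniq (s2 := z :: pmap id [:: troot L; troot R; Some w; Some v])) //.
    by apply/seq.permP => P; case: (troot L) (troot R) => [?|] [?|] /=; ring.
  apply: subseq_uniq uO;
    have sc (a b : seq (vertex Q)) : subseq a b -> subseq (z :: a) (z :: b).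
    by rewrite /= eqxx.
  apply: sc; do 2 apply: subseq_troot.
  by rewrite /= eqxx sub1seq.
- move=> p q /CO h; have nz a : [|| a \in labels L, a \in labels R | a \in O] -> a != z.
    by apply: contraTneq => ->; rewrite !negb_or zL zR zO.
  by case: h => -[pin qin]; rewrite !nz // ?pin ?qin ?orbT.
- move=> p q /mem_troot pL [<-]; apply/negP => /CO[] [pin qin].
  + exact: LO qin yO.
  + exact: LR pL pin.
  + exact: LO pL pin.
- move=> p q [<-] /mem_troot qR; apply/negP => /CO[] [pin qin].
  + exact: LO pin xO.
  + exact: RO pin xO.
  + exact: RO qR qin.
Qed.

Lemma leafy_or_split (V : eqType) (s : seq (segment V)) : all (@leafy V) s \/
  exists s1 d v z L R s2, s = s1 ++ Segment d v (Node z L R) :: s2.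
Proof.
elim: s => [|[d v [|z L R]] s IH]; first by left.
  case: IH => [ls|[s1 [d' [v' [z [L [R [s2 ->]]]]]]]]; first by left.
  by right; exists (Segment d v Leaf :: s1), d', v', z, L, R, s2.
by right; exists [::], d, v, z, L, R, s.
Qed.

(** Induction on the total number of nodes in the hanging trees, which drops by one when a root
    moves onto the cycle. The weight is kept because 1 + (1 + #L + #R) = (1 + #L) + (1 + #R) and
    both new segments inherit the direction. *)
Lemma cyclic_reachable (Q : quiver) n (s : seq (segment (vertex Q))) e :
  loop2_free Q -> 1 < size s -> cyclic s e -> size (cyc_labels s) = n.+1 ->
  exists2 cw' : 'I_n.+1 -> bool, mutation_reachable Q (cycle_quiver cw') &
    forall c, #|[set i | cw' i == c]| = weight c s.
Proof.
have [M] := ubnP (sumn [seq size (labels (apex g)) | g <- s]).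
elim: M Q s e => // M IH Q s e ltM l2 s1 cyc sz.
have [ls|[s3 [d [v [z [L [R [s2 es]]]]]]]] := leafy_or_split s.
  have [cw' iso we] := cyclic_leafy ls cyc sz.
  by exists cw' => //; apply: reach_iso.
rewrite es in ltM s1 cyc sz.
have cyc' := cyclic_mutation l2 s1 cyc.
have [||||cw' re we] := IH (mutation z) _ _ _ _ _ cyc' _.
- move: ltM; rewrite !map_cat !sumn_cat /split_segment.
  by case: (d); rewrite /= size_cat; lia.
- exact: loop2_free_mutation.
- by move: s1; rewrite !size_cat /split_segment; case: (d) => /=; lia.
- rewrite -sz !cyc_labels_cat !size_cat /split_segment; congr (_ + _).
  by case: (d); rewrite /cyc_labels /= ?size_cat /= ?size_cat /= ?size_cat /=; ring.
exists cw'; first exact: reach_step re.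
move=> c; rewrite we /weight es !big_cat /= big_cons; congr (_ + _).
congr (_ + _); rewrite /split_segment.
by case: (d); rewrite big_cons big_seq1 /= /seg_labels /= size_cat;
  case: (_ == c) => /=; lia.
Qed.

(** * Quivers of the class Q_n *)

(** In a mutation step both sides hold outright: [reach_step] demands the property of its source,
    and every mutation has it. *)
Lemma loop2_free_reachable (Q Q' : quiver) :
  mutation_reachable Q Q' -> (loop2_free Q <-> loop2_free Q').
Proof.
elim=> {Q Q'} [Q Q' /isomorphicP[f [g fK gK] fadj]|Q Q' k l2 _ <-].
  split=> /loop2_freeP l2; apply/loop2_freeP => p q; last by rewrite -!fadj.
  by rewrite -(gK p) -(gK q) !fadj.
by split=> // _; apply: loop2_free_mutation.
Qed.

Lemma loop2_free_opposite (Q : quiver) :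
  (forall a b : arrow Q, src a = tgt b -> tgt a = src b -> False) -> loop2_free Q.
Proof. by move=> h; split=> [a e|a b []]; [apply: (h a a)|apply: h]. Qed.

Lemma loop2_free_dynkin k (o : 'I_k -> bool) : loop2_free (dynkin_A o).
Proof.
apply: loop2_free_opposite => a b /=; case ea : (o a); case eb : (o b);
  move=> /(congr1 val) /= e1 /(congr1 val) /= e2; rewrite /bump /= in e1 e2; try lia.
  by have e : a = b by [apply: val_inj]; rewrite e eb in ea.
by have e : a = b by [apply: val_inj; rewrite /=; lia]; rewrite e eb in ea.
Qed.

Lemma loop2_free_type_A (Q : quiver) : type_A Q -> loop2_free Q.
Proof.
case=> k [o [re|re]]; first by rewrite (loop2_free_reachable re);
  apply: loop2_free_dynkin.
by rewrite -(loop2_free_reachable re); apply: loop2_free_dynkin.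
Qed.

(** Opposite arrows [i] and [j] of equal direction would be the only arrows of the cycle,
    contradicting [nonoriented]; of different directions, they would satisfy [i = j]. *)
Lemma loop2_free_cycle m (cw : 'I_m -> bool) :
  nonoriented cw -> loop2_free (cycle_quiver cw).
Proof.
case/and3P=> m1 /existsP[k ck] /existsP[l cl].
have ordSE (i : 'I_m) : (ordS i : nat) = if i.+1 == m then 0 else i.+1.
  rewrite /=; case: eqP => [->|ni]; first by rewrite modnn.
  by rewrite modn_small //; have := ltn_ord i; lia.
have two (i j x : 'I_m) : i = ordS j -> ordS i = j -> x = i \/ x = j.
  move=> /(congr1 val) /= ; rewrite -[_ %% _]/(nat_of_ord (ordS j)) ordSE => e1.
  move=> /(congr1 val) /= ; rewrite -[_ %% _]/(nat_of_ord (ordS i)) ordSE => e2.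
  have [e|ne] := eqVneq (x : nat) (i : nat); first by left; apply: val_inj.
  right; apply: val_inj => /=; move: e1 e2 ne (ltn_ord x) (ltn_ord i) (ltn_ord j).
  case: eqP; case: eqP; lia.
apply: loop2_free_opposite => i j /=; case ci : (cw i); case cj : (cw j) => e1 e2.
- by case: (two i j l e1 e2) cl => ->; rewrite ?ci ?cj.
- by rewrite e1 cj in ci.
- by rewrite e2 cj in ci.
- by case: (two i j k e2 e1) ck => ->; rewrite ?ci ?cj.
Qed.

Lemma cyc_arcs_nth (V : eqType) (s : seq (segment V)) e :
  cyc_arcs s e = flatten [seq seg_arcs (nth true (map (@dir V) s) i)
     (nth e (starts s) i) (nth e (starts s) i.+1) (nth Leaf (map (@apex V) s) i)
   | i <- iota 0 (size s)].
Proof.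
elim: s => //= g s ->; rewrite -[1]/(1 + 0) iotaDl -map_comp.
by rewrite nth0.
Qed.

(** * From a drawing to a closed list of segments *)

Section DrawingSegments.
Variables (n : nat) (Q : quiver) (D : drawing Q) (hD : in_Qn D n).

Local Notation C := (cycle_vertices D).

(** These sets partition the arrows of [Q]; this is the content of [seg_cover] and [seg_inj]. *)
Definition seg_set (i : 'I_(len D)) : {set arrow Q} :=
  [set a | [|| a == ca D i, on_side a i | a \in arrows_in (branch D i)]].

Lemma cv_cycle i : cv D i \in C.
Proof. exact: imset_f. Qed.

Lemma branchC i x : x \in branch D i -> x \notin C.
Proof.
by move=> xi; rewrite -in_setC -(Qn_cover hD); apply/bigcupP; exists i.
Qed.

Lemma branch_inj i j x : x \in branch D i -> x \in branch D j -> i = j.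
Proof.
move=> xi xj; apply/eqP/negPn/negP => /(Qn_disjoint hD)/pred0P/(_ x).
by rewrite /= xi xj.
Qed.

Lemma ca_cycle i : src (ca D i) \in C /\ tgt (ca D i) \in C.
Proof.
by rewrite (dc_src (Qn_cycle hD)) (dc_tgt (Qn_cycle hD)); split; apply: cv_cycle.
Qed.

Lemma sideP i b c : side D i = Some (b, c) ->
  [/\ src b = tgt (ca D i), tgt b \in branch D i, src c = tgt b,
      tgt c = src (ca D i) & src (ca D i) != tgt (ca D i)].
Proof.
move=> es; have := Qn_branch hD i; rewrite /good_branch es => -[].
case/and4P=> u /eqP e1 /eqP e2 /eqP e3 zb _ _ _; split=> //.
by move: u; rewrite /= !inE e1; case: eqP.
Qed.

Lemma on_sideP a i : on_side a i -> exists b c, side D i = Some (b, c) /\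
  ((a = b /\ src a \in C /\ tgt a \in branch D i) \/ (a = c /\
    src a \in branch D i /\ tgt a \in C)).
Proof.
rewrite /on_side; case es : (side D i) => [[b c]|//].
have [sb zb sc tc _] := sideP es; have [sC tC] := ca_cycle i.
move=> /orP[] /eqP ->; exists b, c; split=> //; [left|right]; split=> //; split=> //.
- by rewrite sb.
- by rewrite sc.
- by rewrite tc.
Qed.

Lemma seg_cover a : exists i, a \in seg_set i.
Proof.
have [sC|sC] := boolP (src a \in C).
  have [|[i ->]|[i h]] := Qn_no_other_arrow hD (a := a) sC.
  - by rewrite /incident eqxx.
  - by exists i; rewrite inE eqxx.
  - by exists i; rewrite inE h orbT.
have [tC|tC] := boolP (tgt a \in C).
  have [|[i ->]|[i h]] := Qn_no_other_arrow hD (a := a) tC.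
  - by rewrite /incident eqxx orbT.
  - by exists i; rewrite inE eqxx.
  - by exists i; rewrite inE h orbT.
have [|i ai] := Qn_union hD (a := a); first by rewrite !inE sC tC.
by exists i; rewrite in_set ai !orbT.
Qed.

Lemma seg_setP a i : a \in seg_set i ->
  a = ca D i \/ (src a \in branch D i /\ (tgt a \in branch D i \/ tgt a \in C)) \/
   (tgt a \in branch D i /\ src a \in C).
Proof.
rewrite in_set; case/or3P=> [/eqP ->|/on_sideP[b [c [_ []]]]|]; first by left.
- by move=> [_ [? ?]]; right; right.
- by move=> [_ [? ?]]; right; left; auto.
- by rewrite in_set => /andP[? ?]; right; left; auto.
Qed.

(** A cycle arrow meets no branch, while a side or branch arrow has an end in its own branch; the
    branches are disjoint. *)
Lemma seg_inj a i j : a \in seg_set i -> a \in seg_set j -> i = j.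
Proof.
move=> /seg_setP ai /seg_setP aj.
have nca k l : a = ca D k -> src a \in branch D l \/ tgt a \in branch D l -> False.
  move=> -> h; have [sC tC] := ca_cycle k.
  by case: h => /branchC; rewrite ?sC ?tC.
case: ai => [ei|ai]; case: aj => [ej|aj].
- by apply: (dc_ca_inj (Qn_cycle hD)); rewrite -ei -ej.
- by case: (nca _ j ei); intuition.
- by case: (nca _ i ej); intuition.
have nC x k : x \in C -> x \in branch D k -> False by move=> xC /branchC; rewrite xC.
case: ai => [[si [ti|ti]]|[ti si]]; case: aj => [[sj [tj|tj]]|[tj sj]];
  try (exact: branch_inj si sj); try (exact: branch_inj ti tj); exfalso;
  by [apply: nC si sj|apply: nC sj si|apply: nC ti tj|apply: nC tj ti].
Qed.

Lemma branch_loop2_free i a b :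
  a \in arrows_in (branch D i) -> b \in arrows_in (branch D i) ->
  src a = tgt b -> tgt a = src b -> False.
Proof.
move=> ai bi e1 e2.
have tA : type_A (full_subquiver (branch D i)).
  have := Qn_branch hD i; rewrite /good_branch; case es : (side D i) => [[b' c']|];
    first by case.
  by move=> e; move: ai; rewrite e !inE.
have [_ /(_ (exist _ a ai) (exist _ b bi))] := loop2_free_type_A tA.
by case; split; apply: val_inj.
Qed.

Lemma loop2_free_Qn : loop2_free Q.
Proof.
apply: loop2_free_opposite => a b e1 e2.
have [i ai] := seg_cover a; have [j bj] := seg_cover b.
have nC x k : x \in branch D k -> x \in C -> False by move=> /branchC xC;
  rewrite (negPf xC).
move: ai bj; rewrite !in_set.
case/or3P=> [/eqP ea|/on_sideP[b1 [c1 [es1 ha]]]|ai];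
case/or3P=> [/eqP eb|/on_sideP[b2 [c2 [es2 hb]]]|bj].
- have [_] := loop2_free_cycle (dc_nonoriented (Qn_cycle hD)).
  move/(_ i j); case; split; apply: (dc_cv_inj (Qn_cycle hD)).
    by rewrite -(dc_src (Qn_cycle hD)) -(dc_tgt (Qn_cycle hD)) -ea -eb.
  by rewrite -(dc_src (Qn_cycle hD)) -(dc_tgt (Qn_cycle hD)) -ea -eb.
- have := ca_cycle i; rewrite -ea e1 e2 => -[h1 h2].
  by case: hb => -[_ [h3 h4]]; [apply: nC h4 h1|apply: nC h3 h2].
- have := ca_cycle i; rewrite -ea e1 e2 => -[h1 h2].
  by move: bj => /andP[h3 h4]; apply: nC h4 h1.
- have := ca_cycle j; rewrite -eb -e1 -e2 => -[h1 h2].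
  by case: ha => -[_ [h3 h4]]; [apply: nC h4 h1|apply: nC h3 h2].
(* Two opposite side arrows share their apex, hence their index; their common end on the cycle would
   then make the cycle arrow a loop. *)
- have [sb1 _ sc1 tc1 ne1] := sideP es1; have [sb2 _ sc2 tc2 ne2] := sideP es2.
  case: ha => -[ea [h1 h2]]; case: hb => -[eb [h3 h4]].
  + by rewrite e1 in h1; apply: nC h4 h1.
  + rewrite e2 in h2; have eij := branch_inj h2 h3.
    by move: ne1; rewrite -sb1 -ea e1 eb tc2 eij eqxx.
  + rewrite e1 in h1; have eij := branch_inj h1 h4.
    by move: ne2; rewrite -sb2 -eb -e2 ea tc1 eij eqxx.
  + by rewrite e1 in h1; apply: nC h1 h4.
- move: bj => /andP[h3 h4]; case: ha => -[_ [h1 h2]].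
    by rewrite e1 in h1; apply: nC h4 h1.
  by rewrite e2 in h2; apply: nC h3 h2.
- have := ca_cycle j; rewrite -eb -e1 -e2 => -[h1 h2].
  by move: ai => /andP[h3 h4]; apply: nC h4 h1.
- move: ai => /andP[h1 h2]; case: hb => -[_ [h3 h4]].
    by rewrite -e2 in h3; apply: nC h2 h3.
  by rewrite -e1 in h4; apply: nC h1 h4.
have eij : i = j by move: ai bj => /andP[h1 h2] /andP[h3 h4]; rewrite e1 in h1;
  apply: branch_inj h1 h4.
by subst j; apply: (@branch_loop2_free i a b); rewrite ?in_set.
Qed.

Lemma side_branch i : match side D i with
  | Some (b, c) => exists l r, let t := Node (tgt b) l r in
      [/\ uniq (labels t), labels t =i branch D i &
          perm_eq (arcs (arrows_in (branch D i))) (tarr t)]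
  | None => branch D i = set0 end.
Proof.
have := Qn_branch hD i; rewrite /good_branch;
  case: (side D i) => [[b c]|//] [_ zb tA le2 tri2].
exact: branch_tree zb tA le2 tri2.
Qed.

Definition branch_repr i (t : tree (vertex Q)) :=
  [/\ uniq (labels t), labels t =i branch D i,
      perm_eq (arcs (arrows_in (branch D i))) (tarr t) &
      troot t = omap (fun bc => tgt bc.1) (side D i)].

Lemma branch_repr_exists : exists t, forall i, branch_repr i (t i).
Proof.
apply: fin_all_exists => i; have := side_branch i; rewrite /branch_repr.
case: (side D i) => [[b c] [l [r [u cov pE]]]|e0]; first by exists (Node (tgt b) l r).
exists Leaf; split=> //; first by move=> x; rewrite e0 !inE.
rewrite e0; rewrite /arcs (_ : arrows_in set0 = set0) ?enum_set0 //.
by apply/setP => a; rewrite !inE.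
Qed.

Lemma perm_seg_set i t : branch_repr i t ->
  perm_eq (arcs (seg_set i)) (seg_arcs (cw D i) (cv D i) (cv D (ordS i)) t).
Proof.
case=> u cov pE rt.
have -> : seg_arcs (cw D i) (cv D i) (cv D (ordS i)) t =
    tri (troot t) (Some (src (ca D i))) (Some (tgt (ca D i))) ++ tarr t.
  by rewrite /seg_arcs (dc_src (Qn_cycle hD)) (dc_tgt (Qn_cycle hD)) /=; case: (cw D i).
rewrite -(perm_cat2l (tri (troot t) (Some (src (ca D i))) (Some (tgt (ca D i))))) in pE.
apply: perm_trans pE; have [sC tC] := ca_cycle i.
case es : (side D i) rt => [[b c]|] /= ->; last first.
  have -> : seg_set i = [set ca D i].
    have := side_branch i; rewrite es => e0; apply/setP => a.
    by rewrite !inE /on_side es e0 !inE orbF.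
  have -> : arcs (arrows_in (branch D i)) = [::].
    have := side_branch i; rewrite es => ->;
      rewrite /arcs (_ : arrows_in set0 = set0) ?enum_set0 //.
    by apply/setP => a; rewrite !inE.
  by rewrite /arcs enum_set1 cats0.
have [sb zb sc tc _] := sideP es; have zC := branchC zb.
(* The order is that of [tri] read from the apex: z -> x, x -> y, y -> z. *)
have pS : perm_eq (enum (seg_set i)) ([:: c; ca D i; b] ++ enum (arrows_in (branch D i))).
  apply: uniq_perm; rewrite ?enum_uniq // ?cat_uniq ?enum_uniq ?andbT.
    apply/andP; split.
      rewrite /= !inE !negb_or andbT; apply/andP; split; first (apply/andP; split).
      - by apply: contraNneq zC => e; rewrite -sc e.
      - by apply: contraNneq zC => e; rewrite -sc e sb.
      - by apply: contraNneq zC => <-.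
    apply/hasPn => a; rewrite mem_enum in_set => /andP[/branchC sa /branchC ta];
      rewrite !inE !negb_or.
    apply/and3P; split.
    - by apply: contraNneq ta => ->; rewrite tc.
    - by apply: contraNneq ta => ->.
    - by apply: contraNneq sa => ->; rewrite sb.
  move=> a; rewrite mem_enum mem_cat mem_enum in_set /on_side es orbA; congr orb.
  by rewrite !inE; case: (a == b); case: (a == c); case: (a == ca D i).
have /permPl -> := perm_map (@ends Q) pS.
by rewrite map_cat /= /ends sb sc tc.
Qed.

Lemma sum_seg_set (F : arrow Q -> nat) : \sum_a F a = \sum_i \sum_(a in seg_set i) F a.
Proof.
rewrite -(partition_disjoint_bigcup _ F); last first.
  move=> i j; apply: contraNT => /pred0Pn[a /andP[ai aj]]; apply/eqP.
  exact: seg_inj ai aj.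
apply: eq_bigl => a; apply/esym/bigcupP; have [i ai] := seg_cover a; by exists i.
Qed.

Lemma sum_vertices (F : vertex Q -> nat) :
  \sum_x F x = \sum_i (F (cv D i) + \sum_(x in branch D i) F x).
Proof.
rewrite big_split /= (bigID (mem C)) /=; congr (_ + _).
  rewrite big_imset //= => i j _ _; exact: (dc_cv_inj (Qn_cycle hD)).
rewrite -(partition_disjoint_bigcup _ F) ?(Qn_cover hD); last exact: Qn_disjoint hD.
by apply: eq_bigl => x; rewrite !inE.
Qed.

Definition drawing_segments (t : 'I_(len D) -> tree (vertex Q)) :=
  [seq Segment (cw D i) (cv D i) (t i) | i <- enum 'I_(len D)].

Lemma cyc_arcs_drawing t e : head e (starts (drawing_segments t)) = e ->
  cyc_arcs (drawing_segments t) e =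
  flatten [seq seg_arcs (cw D i) (cv D i) (cv D (ordS i)) (t i) | i <- enum 'I_(len D)].
Proof.
move=> he; rewrite cyc_arcs_nth size_map size_enum_ord -val_enum_ord -map_comp.
congr flatten; apply: eq_map => i /=;
  rewrite /starts /drawing_segments -(map_comp (@dir _)) -(map_comp (@start _)) -(map_comp (@apex _)).
have sz := size_enum_ord (len D).
have lti : i < size (enum 'I_(len D)) by rewrite sz.
rewrite !(nth_map i _ _ lti) nth_ord_enum /=; congr (seg_arcs _ _ _ _).
have [e1|ne] := eqVneq i.+1 (len D).
  have lt0 : 0 < len D by rewrite -e1.
  rewrite nth_default; last by rewrite size_map sz e1.
  rewrite -[LHS]he /starts /drawing_segments -(map_comp (@start _)) -nth0.
  rewrite (nth_map i) ?sz //= (_ : nth _ _ _ = ordS i) //; apply: val_inj => /=.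
  by rewrite nth_enum_ord // e1 modnn.
have lt : i.+1 < len D by rewrite ltn_neqAle ne ltn_ord.
rewrite (nth_map i) ?sz //= (_ : nth _ _ _ = ordS i) //; apply: val_inj => /=.
by rewrite nth_enum_ord // modn_small.
Qed.

Lemma sum_pred1 (T : finType) (B : {set T}) x : \sum_(y in B) (y == x) = (x \in B).
Proof.
rewrite big_mkcond (bigD1 x) //= eqxx big1 => [|y /negPf ->]; last by case: ifP.
by rewrite addn0; case: ifP.
Qed.

(** All conditions reduce to counting. Each vertex occurs once because the cycle vertices and the
    branches partition the vertices; arrow counts are summed over the partition into the
    [seg_set i]. *)
Lemma cyclic_drawing t e : (forall i, branch_repr i (t i)) ->
  head e (starts (drawing_segments t)) = e -> cyclic (drawing_segments t) e.
Proof.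
move=> tP he; set s := drawing_segments t.
have el : cyc_labels s = flatten [seq cv D i :: labels (t i) | i <- enum 'I_(len D)].
  by rewrite /cyc_labels -map_comp.
have count_labels x : count_mem x (cyc_labels s) = 1.
  rewrite el count_flatten -map_comp sumnE big_map big_enum /=.
  have := sum_vertices (fun y => y == x).
  rewrite (bigD1 x) //= eqxx big1 => [|y /negPf -> //]; rewrite addn0 => h.
  apply: etrans (esym h); apply: eq_bigr => i _; congr (_ + _); have [u cov _ _] := tP i.
  by rewrite sum_pred1 count_uniq_mem // cov.
split=> //.
- by apply/uniq_countP => x; rewrite count_labels.
- by move=> x; rewrite mem_count count_labels.
move=> p q; rewrite cyc_arcs_drawing // count_flatten -map_comp sumnE big_map big_enum /=.
have -> : adj p q = \sum_a (ends a == (p, q)).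
  rewrite /adj -sum1_card big_mkcond; apply: eq_bigr => a _.
  by rewrite inE /ends xpair_eqE; case: (_ && _).
rewrite sum_seg_set; apply: eq_bigr => i _; rewrite -(seq.permP (perm_seg_set (tP i))).
by rewrite count_map -sum1_count big_enum_cond /= -big_mkcondr.
Qed.
End DrawingSegments.

(** * The parameters as sums over the arrows of the cycle *)

Section DrawingParams.
Variables (n : nat) (Q : quiver) (D : drawing Q) (hD : in_Qn D n).

Local Notation C := (cycle_vertices D).

Definition branch_triangles (i : 'I_(len D)) : {set {set arrow Q}} :=
  [set T in triangles Q | T \subset arrows_in (branch D i)].

Definition side_triangle (i : 'I_(len D)) : {set {set arrow Q}} :=
  if side D i is Some (b, c) then [set [set ca D i; b; c]] else set0.

Definition local_triangles i := side_triangle i :|: branch_triangles i.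

Definition local_arrows (i : 'I_(len D)) : {set arrow Q} :=
  (if side D i is Some _ then set0 else [set ca D i]) :|:
  arrows_in (branch D i) :\: cover (branch_triangles i).

Lemma ca_seg_set i : ca D i \in seg_set i.
Proof. by rewrite in_set eqxx. Qed.

Lemma arrows_in_seg_set i : arrows_in (branch D i) \subset seg_set i.
Proof. by apply/subsetP => a ai; rewrite [_ \in seg_set i]in_set ai !orbT. Qed.

Lemma ca_branch i j : ca D i \notin arrows_in (branch D j).
Proof.
rewrite in_set; apply/negP => /andP[/(branchC hD)]; by have [-> _] := ca_cycle hD i.
Qed.

Lemma local_triangle_seg_set i T : T \in local_triangles i -> T \subset seg_set i.
Proof.
rewrite in_setU /side_triangle => /orP[|].
  case es : (side D i) => [[b c]|]; last by rewrite inE.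
  rewrite in_set1 => /eqP ->; apply/subsetP => a; rewrite mem_set3 in_set /on_side es.
  by case/or3P=> ->; rewrite ?orbT.
by rewrite in_set => /andP[_ sub]; apply: subset_trans sub (arrows_in_seg_set i).
Qed.

Lemma side_triangleP i b c : side D i = Some (b, c) -> [set ca D i; b; c] \in triangles Q.
Proof.
move=> es; rewrite in_set; apply/existsP; exists (ca D i); apply/existsP; exists b.
apply/existsP; exists c; rewrite eqxx andbT.
by have := Qn_branch hD i; rewrite /good_branch es => -[].
Qed.

Lemma local_triangle_triangles i T : T \in local_triangles i -> T \in triangles Q.
Proof.
rewrite in_setU /side_triangle => /orP[|]; last by rewrite in_set => /andP[].
case es : (side D i) => [[b c]|]; last by rewrite inE.
by rewrite in_set1 => /eqP ->; apply: side_triangleP.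
Qed.

Lemma local_triangle_neq0 i T : T \in local_triangles i -> exists a, a \in T.
Proof.
move=> /local_triangle_triangles;
  rewrite in_set => /existsP[a /existsP[b /existsP[c /andP[_ /eqP ->]]]].
by exists a; rewrite mem_set3 eqxx.
Qed.

Lemma local_triangle_inj i j T :
  T \in local_triangles i -> T \in local_triangles j -> i = j.
Proof.
move=> Ti Tj; have [a aT] := local_triangle_neq0 Ti.
by apply: (seg_inj hD (a := a));
  [apply: (subsetP (local_triangle_seg_set Ti))|apply:
    (subsetP (local_triangle_seg_set Tj))].
Qed.

Lemma ca_local_triangle i j T : T \in local_triangles i -> ca D j \in T ->
  j = i /\ T \in side_triangle i.
Proof.
move=> Ti jT; split.
  by apply: (seg_inj hD (ca_seg_set j)); apply: (subsetP (local_triangle_seg_set Ti)).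
move: Ti; rewrite in_setU => /orP[//|]; rewrite in_set => /andP[_ /subsetP/(_ _ jT)].
by rewrite (negPf (ca_branch j i)).
Qed.

Lemma local_triangle_chosen i T : T \in local_triangles i -> T \in chosen_triangles D.
Proof.
move=> Ti; rewrite in_set (local_triangle_triangles Ti); apply/forallP => j.
apply/implyP => /(ca_local_triangle Ti)[->]; rewrite /side_triangle.
by case: (side D i) => [[b c]|]; rewrite inE.
Qed.

(** At a corner on the cycle, [a] and [c] would both be side arrows, so [b] would join two apexes.
    No arrow joins different branches, so the apexes coincide and [src b = src c], which is
    absurd. *)
Lemma triangle_corner a b c : oriented_3cycle a b c ->
  (forall j, ca D j \notin [set a; b; c]) -> src a \notin C.
Proof.
case/and4P=> u /eqP ab /eqP bc /eqP ca nca; apply/negP => sC.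
have inc (d : arrow Q) : d \in [set a; b;
  c] -> incident d (src a) -> exists i : 'I_(len D), on_side d i.
  move=> dT /(Qn_no_other_arrow hD sC)[[i ei]|//].
  by case/negP: (nca i); rewrite -ei.
have nC x k : x \in C -> x \in branch D k -> False by move=> xC /(branchC hD); rewrite xC.
have [i sa] : exists i : 'I_(len D), on_side a i.
  by apply: inc; rewrite ?mem_set3 /incident ?eqxx.
have [k sc] : exists k : 'I_(len D), on_side c k.
  by apply: inc; rewrite ?mem_set3 /incident ?ca ?eqxx ?orbT.
have [b1 [c1 [es1 [[ea [_ h1]]|[_ [h1 _]]]]]] := on_sideP hD sa; last exact: nC sC h1.
have [b2 [c2 [es2 [[_ [_ h2]]|[ec [h2 _]]]]]] := on_sideP hD sc.
  by rewrite ca in h2; apply: nC sC h2.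
have [|l] := Qn_union hD (a := b).
  by rewrite in_set -ab bc !in_setC (branchC hD h1) (branchC hD h2).
rewrite in_set -ab bc => /andP[hl1 hl2].
have eil := branch_inj hD h1 hl1; have ekl := branch_inj hD h2 hl2; subst i k.
move: es2; rewrite es1 => -[e1 e2].
have [_ _ e3 _ _] := sideP hD es1.
have e : src b = src c by rewrite -ab ea ec -e2 e3.
by move: u; rewrite /= !inE e eqxx andbF.
Qed.

Lemma arrows_inP (a b c : arrow Q) (S : {set vertex Q}) :
  src a \in S -> src b \in S -> src c \in S ->
  oriented_3cycle a b c -> {subset [set a; b; c] <= arrows_in S}.
Proof.
move=> sa sb sc /and4P[_ /eqP ab /eqP bc /eqP ca] d; rewrite mem_set3 in_set.
by case/or3P=> /eqP ->; rewrite ?ab ?bc ?ca ?sa ?sb ?sc.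
Qed.

(** Through a cycle arrow, the choice itself forces the side triangle. Otherwise [triangle_corner],
    applied to the three rotations, puts all corners off the cycle, and then all arrows lie in one
    branch. *)
Lemma chosen_local T : T \in chosen_triangles D -> exists i, T \in local_triangles i.
Proof.
rewrite in_set => /andP[TQ /forallP ch].
have [/existsP[j jT]|/existsPn nca] := boolP [exists j, ca D j \in T].
  exists j; have := ch j; rewrite jT /= in_setU /side_triangle.
  by case: (side D j) => [[b c]|//] /eqP ->; rewrite in_set1 eqxx.
move: (TQ); rewrite in_set => /existsP[a /existsP[b /existsP[c /andP[abc /eqP eT]]]].
have rot3 x y w : [set x; y; w] = [set y; w; x] :> {set arrow Q}.
  by apply/setP => d; rewrite !mem_set3 orbC -orbA.
have rotc x y w : @oriented_3cycle Q x y w -> oriented_3cycle y w x.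
  case/and4P=> u xy yw wx; rewrite /oriented_3cycle xy yw wx !andbT.
  by rewrite -(rot_uniq 1) in u.
have sa : src a \notin C by apply: (triangle_corner abc) => j; rewrite -eT.
have sb : src b \notin C.
  by apply: (triangle_corner (rotc _ _ _ abc)) => j; rewrite -rot3 -eT.
have sc : src c \notin C.
  by apply: (triangle_corner (rotc _ _ _ (rotc _ _ _ abc))) => j; rewrite -rot3 -rot3 -eT.
have inC : {subset [set a; b; c] <= arrows_in (~: C)}.
  by apply: arrows_inP; rewrite ?in_setC.
have [|i] := Qn_union hD (a := a); first by apply: inC; rewrite mem_set3 eqxx.
have [|j] := Qn_union hD (a := b); first by apply: inC; rewrite mem_set3 eqxx orbT.
rewrite !in_set => /andP[bj1 bj2] /andP[ai1 ai2].
have /and4P[_ /eqP ab /eqP bc _] := abc.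
rewrite ab in ai2; have eij := branch_inj hD ai2 bj1; subst j.
exists i; rewrite in_setU; apply/orP; right; rewrite in_set TQ eT.
by apply/subsetP; apply: arrows_inP; rewrite // -bc.
Qed.

Lemma param2E c : param2 D c = \sum_i (if cw D i == c then #|local_triangles i| else 0).
Proof.
pose F i := if cw D i == c then local_triangles i else set0.
have -> : param2 D c = #|\bigcup_i F i|.
  apply: eq_card => T; rewrite [LHS]in_set; apply/andP/bigcupP => [[Tch]|[i _]].
    case/existsP=> i /andP[ci h]; exists i => //; rewrite /F ci.
    have [j Tj] := chosen_local Tch; case/orP: h => [iT|sub].
      by have [-> _] := ca_local_triangle Tj iT.
    rewrite in_setU; apply/orP; right; rewrite in_set sub andbT.
    exact: local_triangle_triangles Tj.
  rewrite /F; case: ifP => [ci Ti|_]; last by rewrite inE.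
  split; first exact: local_triangle_chosen Ti.
  apply/existsP; exists i; rewrite ci /=; move: Ti; rewrite in_setU => /orP[|];
    last first.
    by rewrite in_set => /andP[_ ->]; rewrite orbT.
  rewrite /side_triangle; case: (side D i) => [[b c']|]; last by rewrite inE.
  by rewrite in_set1 => /eqP ->; rewrite mem_set3 eqxx.
rewrite -sum1_card (partition_disjoint_bigcup _ (fun=> 1)); last first.
  move=> i j; apply: contraNT => /pred0Pn[T /andP[/= Ti Tj]]; apply/eqP; move: Ti Tj.
  rewrite /F; case: ifP => _ Ti; last by rewrite inE in Ti.
  case: ifP => _ Tj; last by rewrite inE in Tj.
  exact: local_triangle_inj Ti Tj.
by apply: eq_bigr => i _; rewrite sum1_card /F; case: ifP; rewrite ?cards0.
Qed.

(** Each arrow of a side triangle touches the cycle, so it is never an arrow of the branch. *)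
Lemma branch_arrow_cover i a : a \in arrows_in (branch D i) ->
  (a \in cover (chosen_triangles D)) = (a \in cover (branch_triangles i)).
Proof.
move=> ai; apply/bigcupP/bigcupP => -[T TS aT]; exists T => //; last first.
  by apply: (@local_triangle_chosen i); rewrite in_setU TS orbT.
have [j Tj] := chosen_local TS.
have eij : j = i.
  apply: (seg_inj hD (a := a)); first exact: (subsetP (local_triangle_seg_set Tj)).
  exact: (subsetP (arrows_in_seg_set i)).
subst j; move: Tj; rewrite in_setU => /orP[|//].
rewrite /side_triangle; case es : (side D i) => [[b c]|]; last by rewrite inE.
rewrite in_set1 => /eqP eT; move: aT; rewrite eT mem_set3.
have [sb _ _ tc _] := sideP hD es; have [sC tC] := ca_cycle hD i.
move: ai; rewrite in_set => /andP[/(branchC hD) sa /(branchC hD) ta].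
by case/or3P=> /eqP e; rewrite e ?sb ?tc ?sC ?tC in sa ta.
Qed.

(** For a double arrow, [ca D i] also forms a 3-cycle with the side arrows of its twin. That 3-cycle
    is not chosen, so only the side of [i] itself matters. *)
Lemma ca_cover i : (ca D i \in cover (chosen_triangles D)) = (side D i != None).
Proof.
apply/bigcupP/idP => [[T Tch iT]|].
  move: Tch; rewrite in_set => /andP[_ /forallP/(_ i)]; rewrite iT /=.
  by case: (side D i).
case es : (side D i) => [[b c]|//] _; exists [set ca D i; b; c];
  last by rewrite mem_set3 eqxx.
by apply: (@local_triangle_chosen i); rewrite in_setU /side_triangle es in_set1 eqxx.
Qed.

Lemma param1E c : param1 D c = \sum_i (if cw D i == c then #|local_arrows i| else 0).
Proof.
pose F i := if cw D i == c then local_arrows i else set0.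
have mem_loc i a : (a \in local_arrows i) = (a \notin cover (chosen_triangles D)) &&
    ((a == ca D i) || (a \in arrows_in (branch D i))).
  rewrite in_setU in_setD; have [ai|nai] := boolP (a \in arrows_in (branch D i)).
    have na : a != ca D i by apply: contraTneq ai => ->; apply: ca_branch.
    rewrite (branch_arrow_cover ai) (negPf na) /= !andbT.
    by case: (side D i) => [_|]; rewrite ?in_set1 ?inE ?(negPf na).
  rewrite andbF !orbF; have [ea|na] := eqVneq a (ca D i).
    by rewrite ea ca_cover; case: (side D i) => [?|]; rewrite ?in_set1 ?inE ?eqxx.
  by rewrite andbF; case: (side D i) => [_|]; rewrite ?in_set1 ?inE ?(negPf na).
have loc_seg i a : a \in local_arrows i -> a \in seg_set i.
  rewrite mem_loc => /andP[_ /orP[/eqP ->|ai]]; first exact: ca_seg_set.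
  exact: (subsetP (arrows_in_seg_set i)).
have -> : param1 D c = #|\bigcup_i F i|.
  apply: eq_card => a; rewrite [LHS]in_set; apply/andP/bigcupP => [[na]|[i _]].
    by case/existsP=> i /andP[ci h]; exists i => //; rewrite /F ci mem_loc na.
  rewrite /F; case: ifP => [ci|_]; last by rewrite inE.
  rewrite mem_loc => /andP[-> h]; split=> //; apply/existsP; exists i.
  by rewrite ci.
rewrite -sum1_card (partition_disjoint_bigcup _ (fun=> 1)); last first.
  move=> i j; apply: contraNT => /pred0Pn[a /andP[/= ai aj]]; apply/eqP; move: ai aj.
  rewrite /F; case: ifP => _ ai; last by rewrite inE in ai.
  case: ifP => _ aj; last by rewrite inE in aj.
  exact: (seg_inj hD (loc_seg _ _ ai) (loc_seg _ _ aj)).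
by apply: eq_bigr => i _; rewrite sum1_card /F; case: ifP; rewrite ?cards0.
Qed.

(** With u free arrows and t 3-cycles in a nonempty branch, [tree_params] gives u + 2t + 1 nodes;
    the side triangle adds 2 on the left, and the cycle arrow is then not counted. Without a side,
    the left is the cycle arrow alone and the branch is empty. *)
Lemma local_params i : #|local_arrows i| + 2 * #|local_triangles i| = #|branch D i|.+1.
Proof.
have := side_branch hD i; rewrite /local_triangles /local_arrows /side_triangle.
case es : (side D i) => [[b c]|] => [[l [r [u cov pE]]]|e0].
  have <- := tree_params u cov pE.
  rewrite set0U cardsU1 -/(branch_triangles i).
  rewrite (_ : _ \notin _ = true); first lia.
  apply/negP; rewrite in_set => /andP[_ /subsetP/(_ (ca D i))].
  by rewrite mem_set3 eqxx (negPf (ca_branch i i)) => /(_ isT).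
have eA : arrows_in (branch D i) = set0 by rewrite e0; apply/setP => a; rewrite !inE.
have -> : branch_triangles i = set0.
  apply/setP => T; rewrite [RHS]inE; apply/negP => Ti.
  have [a aT] : exists a, a \in T by apply: (@local_triangle_neq0 i);
    rewrite in_setU Ti orbT.
  by move: Ti; rewrite in_set => /andP[_ /subsetP/(_ a aT)]; rewrite eA inE.
by rewrite eA set0D !setU0 cards1 cards0 e0 cards0.
Qed.

Lemma weight_params (t : 'I_(len D) -> tree (vertex Q)) c :
  (forall i, branch_repr i (t i)) ->
  weight c (drawing_segments t) = param1 D c + 2 * param2 D c.
Proof.
move=> tP; rewrite /weight big_map big_enum /= param1E param2E big_distrr /= -big_split.
apply: eq_bigr => i _; have [u cov _ _] := tP i.
rewrite -(card_uniqP u) (eq_card cov) -local_params.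
by case: (cw D i == c); rewrite ?mul1n ?mul0n.
Qed.

End DrawingParams.

Theorem theorem3p10 (n : nat) (hn : 1 <= n) (Q : quiver) (D : drawing Q)
    (hD : in_Qn D n) :
  exists cw' : 'I_n.+1 -> bool,
    [/\ nonoriented cw',
        #|[set i | ~~ cw' i]| = r1 D + 2 * r2 D,
        #|[set i | cw' i]| = s1 D + 2 * s2 D &
        mutation_equivalent Q (cycle_quiver cw')].
Proof.
have [t tP] := branch_repr_exists hD.
have /and3P[m1 /existsP[k ck] /existsP[k' ck']] := dc_nonoriented (Qn_cycle hD).
pose s := drawing_segments t; pose e := head (cv D k) (starts s).
have sz : size s = len D by rewrite size_map size_enum_ord.
have he : head e (starts s) = e by rewrite /e; case: (starts s).
have cyc := cyclic_drawing hD tP he.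
have szl : size (cyc_labels s) = n.+1.
  have [u cov _ _] := cyc; rewrite -(Qn_card hD) -(card_uniqP u).
  by apply: eq_card => x; rewrite cov.
have m1' : 1 < size s by rewrite sz.
have [cw' re we] := cyclic_reachable (loop2_free_Qn hD) m1' cyc szl.
(* The given cycle has an arrow in each direction, so both weights are positive and the final cycle
   is again non-oriented. *)
have pos c i : cw D i = c -> exists j, cw' j == c.
  move=> ci; have : 0 < #|[set j | cw' j == c]|.
    by rewrite we /weight big_map big_enum (bigD1 i) //= ci eqxx.
  by case/card_gt0P=> j; rewrite inE => ?; exists j.
have eF : [set i | ~~ cw' i] = [set i | cw' i == false].
  by apply/setP => i; rewrite !inE; case: (cw' i).
have eT : [set i | cw' i] = [set i | cw' i == true].
  by apply/setP => i; rewrite !inE; case: (cw' i).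
exists cw'; split; last by left.
- rewrite /nonoriented ltnS hn /=; apply/andP; split; apply/existsP.
    by have [j /eqP] := pos true k ck; exists j.
  by have [j /eqP jF] := pos false k' (negPf ck'); exists j; rewrite jF.
- by rewrite eF we (weight_params hD).
- by rewrite eT we (weight_params hD).
Qed.
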